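(* Let $m>0$ be an integer and let $\tau\in\mathbb{C}\setminus\mathbb{R}$. Then \[ (1+\tau)^{2m-1}\,\psi_{2m}\!\left(\frac{\tau}{1+\tau}\right)-(1-\tau)^{2m-1}\,\psi_{2m}\!\left(\frac{\tau}{1-\tau}\right) =\pi^{2m}\,[z^{2m-1}]\,\frac{\sin(\tau z)}{\sin((1-\tau)z)\,\sin((1+\tau)z)} . \]
   Context: For an integer $s$ and nonreal $\tau$, the secant Dirichlet series is $\psi_s(\tau)=\sum_{n=1}^{\infty}\frac{\sec(\pi n\tau)}{n^s}$ (absolutely convergent for nonreal $\tau$). For a function $f$ meromorphic near $z=0$, $[z^n]f(z)$ denotes the coefficient of $z^n$ in its Laurent expansion at $z=0$. *)

(* Defs.v *)
From Stdlib Require Import Reals ZArith Lra Lia.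
From Coquelicot Require Import Coquelicot.

Open Scope C_scope.

Definition Cexp (z : C) : C := RtoC (exp (Re z)) * (cos (Im z), sin (Im z)).

Definition Csin (z : C) : C := (Cexp (Ci * z) - Cexp (- (Ci * z))) / (2 * Ci).

Definition Ccos (z : C) : C := (Cexp (Ci * z) + Cexp (- (Ci * z))) / 2.

Definition Csec (z : C) : C := / Ccos z.

(* [Series] is only available over R, hence [iota] for the limit of a complex
   series.  The index is shifted: the k-th term is the one of n = k + 1. *)
Definition secant_term (s : Z) (tau : C) (k : nat) : C :=
  Csec (PI * INR (S k) * tau) / RtoC (powerRZ (INR (S k)) s).

Definition psi (s : Z) (tau : C) : C :=
  iota (T := CompleteNormedModule.CompleteSpace C_AbsRing C_CompleteNormedModule)
    (is_series (K := C_AbsRing) (V := C_NormedModule) (secant_term s tau)).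

(* [a k] is the coefficient of z^k; with p a bound on the order of the pole,
   f z = sum_(k >= -p) (a k) z^k is written with k = j - p for j a natural
   number. *)
Definition is_laurent_expansion (f : C -> C) (a : Z -> C) : Prop :=
  exists (p : nat) (r : R),
    (forall k : Z, (k < - Z.of_nat p)%Z -> a k = 0) /\
    (0 < r)%R /\
    forall z : C, (0 < Cmod z < r)%R ->
      is_series (K := C_AbsRing) (V := C_NormedModule)
        (fun j : nat => a (Z.of_nat j - Z.of_nat p)%Z * (z ^ j / z ^ p)) (f z).

(* The value is unspecified when f has no Laurent expansion with finite
   principal part at 0. *)
Definition laurent_coef (n : Z) (f : C -> C) : C :=
  iota (T := CompleteNormedModule.CompleteSpace C_AbsRing C_CompleteNormedModule)
    (fun c : C => exists a : Z -> C, is_laurent_expansion f a /\ c = a n).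

Lemma psi_unique (s : Z) (tau l : C) :
  is_series (K := C_AbsRing) (V := C_NormedModule) (secant_term s tau) l ->
  psi s tau = l.
Proof.
intros H.
apply (iota_unique (V := C_CompleteNormedModule)); [|exact H].
intros y Hy.
exact (filterlim_locally_unique (V := C_NormedModule) _ _ _ Hy H).
Qed.

Lemma real_pseries_zero (n : nat) : forall (e : nat -> R) (r : R), (0 < r)%R ->
  (forall x : R, (0 < x < r)%R -> is_pseries e x 0%R) -> e n = 0%R.
Proof.
assert (Hcv : forall (e : nat -> R) (r : R), (0 < r)%R ->
  (forall x : R, (0 < x < r)%R -> is_pseries e x 0%R) ->
  Rbar_lt 0 (CV_radius e)).
{ intros e r Hr H.
  apply Rbar_lt_le_trans with (Finite (r / 2)); [simpl; lra|].
  apply Rbar_not_lt_le; intros Hlt.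
  apply (CV_disk_outside e (r / 2)).
  - rewrite Rabs_pos_eq by lra; exact Hlt.
  - assert (Hex : ex_series (fun n : nat => (e n * (r / 2) ^ n)%R)).
    { exists 0%R.
      apply is_series_ext with (2 := H (r / 2)%R ltac:(lra)).
      intros k; rewrite pow_n_pow; unfold scal; simpl; unfold mult; simpl; ring. }
    exact (ex_series_lim_0 _ Hex). }
assert (H0 : forall (e : nat -> R) (r : R), (0 < r)%R ->
  (forall x : R, (0 < x < r)%R -> is_pseries e x 0%R) -> e O = 0%R).
{ intros e r Hr H.
  rewrite <- (PSeries_0 e).
  assert (Hc : continuous (PSeries e) 0%R).
  { apply continuity_pt_filterlim, PSeries_continuity.
    rewrite Rabs_R0; exact (Hcv e r Hr H). }
  apply (filterlim_locally_unique (V := R_NormedModule)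
           (F := at_right 0%R) (PSeries e)).
  - apply filterlim_filter_le_1 with (2 := Hc).
    intros P HP; apply filter_le_within; exact HP.
  - apply filterlim_ext_loc with (fun _ => 0%R).
    + exists (mkposreal r Hr); intros y Hy Hy0.
      symmetry; apply is_pseries_unique, H.
      apply Rabs_lt_between' in Hy; simpl in Hy; lra.
    + apply filterlim_const. }
induction n as [|n IH]; intros e r Hr H; [exact (H0 e r Hr H)|].
apply (IH (fun k => e (S k)) r Hr).
intros x Hx.
pose proof (is_pseries_decr_1 e x (/ x)%R 0%R) as D.
replace 0%R with (scal (/ x)%R (plus 0%R (opp (e O))) : R).
- apply D; [unfold mult, one; simpl; field; lra|exact (H x Hx)].
- rewrite (H0 e r Hr H); unfold scal, plus, opp; simpl; unfold mult; simpl; ring.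
Qed.

Lemma laurent_expansion_unique (f : C -> C) (a b : Z -> C) :
  is_laurent_expansion f a -> is_laurent_expansion f b -> forall n, a n = b n.
Proof.
assert (Hstep : forall (a : Z -> C) (p : nat) (z l : C), z <> 0 ->
  (forall k : Z, (k < - Z.of_nat p)%Z -> a k = 0) ->
  is_series (K := C_AbsRing) (V := C_NormedModule)
    (fun j : nat => a (Z.of_nat j - Z.of_nat p)%Z * (z ^ j / z ^ p)) l ->
  forall q, is_series (K := C_AbsRing) (V := C_NormedModule)
    (fun j : nat => a (Z.of_nat j - Z.of_nat (q + p))%Z * (z ^ j / z ^ (q + p))) l).
{ intros c p z l Hz Hc H; induction q as [|q IH]; [exact H|].
  apply (is_series_decr_1 (K := C_AbsRing) (V := C_NormedModule)).
  match goal with |- is_series _ ?x => replace x with l end.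
  - apply is_series_ext with (2 := IH); intros k.
    replace (Z.of_nat (S k) - Z.of_nat (S q + p))%Z
      with (Z.of_nat k - Z.of_nat (q + p))%Z by lia.
    replace (S q + p)%nat with (S (q + p)) by lia.
    rewrite !Cpow_S.
    match goal with |- ?x = ?y => change (@eq C x y) end.
    field; split; try assumption; apply Cpow_nz; assumption.
  - rewrite (Hc (Z.of_nat 0 - Z.of_nat (S q + p))%Z) by lia.
    match goal with |- _ = plus _ (opp (Cmult _ ?t)) =>
      change (l = l + - (0 * t)) end.
    ring. }
intros (p & r & Ha & Hr & H) (p' & r' & Hb & Hr' & H') n.
assert (Hd : forall k : nat, a (Z.of_nat k - Z.of_nat (p + p'))%Z
                      = b (Z.of_nat k - Z.of_nat (p + p'))%Z).
{ set (d := fun k : nat => a (Z.of_nat k - Z.of_nat (p + p'))%Z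
                    - b (Z.of_nat k - Z.of_nat (p + p'))%Z).
  assert (Hs : forall x : R, (0 < x < Rmin r r')%R ->
    is_series (K := C_AbsRing) (V := C_NormedModule)
      (fun j => d j * RtoC (x ^ j)) (RtoC 0)).
  { intros x [Hx0 Hx].
    pose proof (Rmin_l r r'); pose proof (Rmin_r r r').
    assert (Hz : RtoC x <> 0) by (intros E; apply RtoC_inj in E; lra).
    assert (Hm : Cmod x = x) by (rewrite Cmod_R; apply Rabs_pos_eq; lra).
    assert (S1 := Hstep a p x (f x) Hz Ha (H x ltac:(rewrite Hm; lra)) p').
    assert (S2 := Hstep b p' x (f x) Hz Hb (H' x ltac:(rewrite Hm; lra)) p).
    rewrite (Nat.add_comm p' p) in S1.
    assert (S3 := is_series_scal (K := C_AbsRing) (V := C_NormedModule)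
      (RtoC x ^ (p + p')) _ _ (is_series_minus _ _ _ _ S1 S2)).
    match type of S3 with is_series _ ?y => replace y with (RtoC 0) in S3 end.
    - apply is_series_ext with (2 := S3); intros k.
      match goal with |- scal ?u (plus ?v (opp ?w)) = _ =>
        change (u * (v + - w) = d k * RtoC (x ^ k)) end.
      unfold d; rewrite RtoC_pow; field; apply Cpow_nz; exact Hz.
    - match goal with |- _ = scal ?u (plus ?v (opp ?w)) =>
        change (RtoC 0 = u * (v + - w)) end.
      ring. }
  assert (Hk : forall g : C -> R,
    (forall u v, g (u + v) = (g u + g v)%R) ->
    (forall u (t : R), g (u * RtoC t) = (g u * t)%R) ->
    (forall u, continuous (T := C_UniformSpace) (U := R_UniformSpace) g u) ->
    forall k, g (d k) = 0%R).
  { intros g Hadd Hmul Hcont k.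
    apply (real_pseries_zero k (fun j => g (d j)) (Rmin r r')).
    - apply Rmin_pos; assumption.
    - intros x Hx.
      assert (G : filterlim (fun N => g (sum_n (G := C_AbelianMonoid)
          (fun j => d j * RtoC (x ^ j)) N)) eventually (locally (g 0))).
      { exact (filterlim_comp _ _ _ _ _ _ _ _ (Hs x Hx) (Hcont (RtoC 0))). }
      replace (g 0) with 0%R in G by
        (rewrite <- (Cmult_0_l (RtoC 0)), Hmul; ring).
      apply filterlim_ext with (2 := G); intros N.
      assert (Ht : forall i, g (d i * RtoC (x ^ i)) = scal (pow_n x i) (g (d i))).
      { intros i; rewrite Hmul, <- (pow_n_pow x i); apply Rmult_comm. }
      induction N as [|N IH]; [rewrite !sum_O; apply Ht|].
      rewrite !sum_Sn, <- IH, <- Ht; apply Hadd. }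
  intros k.
  assert (E : d k = 0).
  { apply injective_projections; simpl.
    - apply (Hk fst).
      + reflexivity.
      + intros [u1 u2] t; simpl; ring.
      + intros u; apply continuous_fst.
    - apply (Hk snd).
      + reflexivity.
      + intros [u1 u2] t; simpl; ring.
      + intros u; apply continuous_snd. }
  unfold d in E.
  replace (a (Z.of_nat k - Z.of_nat (p + p'))%Z)
    with (a (Z.of_nat k - Z.of_nat (p + p'))%Z - b (Z.of_nat k - Z.of_nat (p + p'))%Z
          + b (Z.of_nat k - Z.of_nat (p + p'))%Z) by ring.
  rewrite E; ring. }
destruct (Z_lt_le_dec n (- Z.of_nat (p + p'))) as [Hn|Hn].
- rewrite Ha, Hb by lia; reflexivity.
- specialize (Hd (Z.to_nat (n + Z.of_nat (p + p')))).
  rewrite Z2Nat.id in Hd by lia.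
  replace (n + Z.of_nat (p + p') - Z.of_nat (p + p'))%Z with n in Hd by lia.
  exact Hd.
Qed.

Lemma laurent_coef_unique (f : C -> C) (a : Z -> C) (n : Z) :
  is_laurent_expansion f a -> laurent_coef n f = a n.
Proof.
intros H.
apply (iota_unique (V := C_CompleteNormedModule)).
- intros c (b & Hb & ->); exact (laurent_expansion_unique f b a Hb H n).
- exists a; split; [exact H|reflexivity].
Qed.

(* Main.v *)
(* Since [2 tau z = (1 + tau) z - (1 - tau) z], writing a = 1 - tau and b = 1 + tau,
   [sin (tau z) / (sin (a z) sin (b z))
    = (csc (a z / 2) sec (b z / 2) - csc (b z / 2) sec (a z / 2)) / 4].
   The partial fraction expansions of csc and sec follow from iterating
   [2 / sin y = cot (y / 2) - cot ((y + PI) / 2)] and dominated convergence.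
   Multiplying the truncated expansions of csc (a z / 2) and sec (b z / 2) and
   splitting each product of two simple poles gives, since a / b is nonreal and
   the truncations are therefore uniformly bounded at the poles of the other
   factor, the partial fraction expansion of the quotient: its residues at
   j PI / a and j PI / b are secants of j PI tau / a and j PI tau / b.
   Expanding each pole as a geometric series in z yields the values of psi. *)

Require Import Defs.
From Stdlib Require Import Reals ZArith Lra Lia.
From Coquelicot Require Import Coquelicot.

Open Scope C_scope.

(** * Limits and partial sums of complex sequences *)

(** The partial fraction series of sec converges only conditionally, so no infinite double series is
    formed: the two expansions are multiplied at equal truncation n, where the splitting is an exact
    finite identity whose residues still depend on n, and only then does n tend to infinity. The
    weights multiplying these residues already decay like 1/k^2, so boundedness of the residues,
    uniform in n and in the pole, is all that [tannery] requires. For x = a z, the poles of csc (x /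
    2) sit at the even multiples of PI and those of sec (x / 2) at the odd ones. Each of the two
    products carries only half of the poles belonging to a and half of those belonging to b; their
    difference assembles both full sequences. Shifting arguments by multiples of PI turns every
    residue into a secant and cancels the alternating signs. The geometric series in z is peeled off
    one term at a time with an exact remainder, which replaces a second exchange of infinite
    sums. *)

Definition cvg (u : nat -> C) (l : C) : Prop :=
  forall eps : R, (0 < eps)%R ->
  exists N : nat, forall n : nat, (N <= n)%nat -> (Cmod (u n - l) < eps)%R.

Lemma Cmod_sym (a b : C) : Cmod (a - b) = Cmod (b - a).
Proof. rewrite <- Cmod_opp; f_equal; ring. Qed.

Lemma Cmod_sub_triangle (a b c : C) : (Cmod (a - c) <= Cmod (a - b) + Cmod (b - c))%R.
Proof. replace (a - c) with ((a - b) + (b - c)) by ring; apply Cmod_triangle. Qed.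

Lemma Cmod_sub_ge (a b : C) : (Cmod a - Cmod b <= Cmod (a - b))%R.
Proof.
pose proof (Cmod_triangle (a - b) b) as H.
replace (a - b + b) with a in H by ring; lra.
Qed.

Lemma Cmod_sub_le (a b : C) : (Cmod (a - b) <= Cmod a + Cmod b)%R.
Proof. rewrite <- (Cmod_opp b); apply Cmod_triangle. Qed.

Lemma cvg_unique (u : nat -> C) (l l' : C) : cvg u l -> cvg u l' -> l = l'.
Proof.
intros H H'.
destruct (Req_dec (Cmod (l - l')) 0) as [E|E].
- apply Cmod_eq_0 in E; replace l with (l - l' + l') by ring; rewrite E; ring.
- exfalso; pose proof (Cmod_ge_0 (l - l')).
  destruct (H (Cmod (l - l') / 2)%R ltac:(lra)) as [N HN].
  destruct (H' (Cmod (l - l') / 2)%R ltac:(lra)) as [N' HN'].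
  specialize (HN (N + N')%nat ltac:(lia)); specialize (HN' (N + N')%nat ltac:(lia)).
  pose proof (Cmod_sub_triangle l (u (N + N')%nat) l') as T.
  rewrite (Cmod_sym l (u _)) in T; lra.
Qed.

Lemma cvg_ext (u v : nat -> C) (l : C) : (forall n, u n = v n) -> cvg u l -> cvg v l.
Proof.
intros E H eps He; destruct (H eps He) as [N HN]; exists N; intros n Hn.
rewrite <- E; auto.
Qed.

Lemma cvg_lim_eq (u : nat -> C) (l l' : C) : l = l' -> cvg u l -> cvg u l'.
Proof. intros <-; trivial. Qed.

Lemma cvg_const (c : C) : cvg (fun _ => c) c.
Proof.
intros eps He; exists O; intros n _.
replace (c - c) with (RtoC 0) by ring; rewrite Cmod_0; exact He.
Qed.

Lemma cvg_plus (u v : nat -> C) (l k : C) :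
  cvg u l -> cvg v k -> cvg (fun n => u n + v n) (l + k).
Proof.
intros H H' eps He.
destruct (H (eps / 2)%R ltac:(lra)) as [N HN].
destruct (H' (eps / 2)%R ltac:(lra)) as [N' HN'].
exists (N + N')%nat; intros n Hn.
specialize (HN n ltac:(lia)); specialize (HN' n ltac:(lia)).
replace (u n + v n - (l + k)) with ((u n - l) + (v n - k)) by ring.
pose proof (Cmod_triangle (u n - l) (v n - k)); lra.
Qed.

Lemma cvg_bounded (u : nat -> C) (l : C) : cvg u l ->
  exists N, forall n, (N <= n)%nat -> (Cmod (u n) <= Cmod l + 1)%R.
Proof.
intros H; destruct (H 1%R Rlt_0_1) as [N HN]; exists N; intros n Hn.
specialize (HN n Hn); pose proof (Cmod_sub_ge (u n) l); lra.
Qed.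

Lemma cvg_mult (u v : nat -> C) (l k : C) :
  cvg u l -> cvg v k -> cvg (fun n => u n * v n) (l * k).
Proof.
intros H H' eps He.
destruct (cvg_bounded u l H) as [N0 HN0].
pose proof (Cmod_ge_0 l); pose proof (Cmod_ge_0 k).
destruct (H (eps / (2 * (Cmod k + 1)))%R) as [N HN].
{ apply Rdiv_lt_0_compat; lra. }
destruct (H' (eps / (2 * (Cmod l + 1)))%R) as [N' HN'].
{ apply Rdiv_lt_0_compat; lra. }
exists (N0 + N + N')%nat; intros n Hn.
specialize (HN0 n ltac:(lia)); specialize (HN n ltac:(lia)); specialize (HN' n ltac:(lia)).
replace (u n * v n - l * k) with (u n * (v n - k) + (u n - l) * k) by ring.
pose proof (Cmod_triangle (u n * (v n - k)) ((u n - l) * k)) as T.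
rewrite !Cmod_mult in T.
assert (A : (Cmod (u n) * Cmod (v n - k) <= (Cmod l + 1) * (eps / (2 * (Cmod l + 1))))%R).
{ apply Rmult_le_compat; try apply Cmod_ge_0; lra. }
assert (B : (Cmod (u n - l) * Cmod k < (eps / (2 * (Cmod k + 1))) * (Cmod k + 1))%R).
{ apply Rle_lt_trans with (eps / (2 * (Cmod k + 1)) * Cmod k)%R.
  - apply Rmult_le_compat_r; lra.
  - apply Rmult_lt_compat_l; [apply Rdiv_lt_0_compat; lra|lra]. }
replace ((Cmod l + 1) * (eps / (2 * (Cmod l + 1))))%R with (eps / 2)%R in A by (field; lra).
replace (eps / (2 * (Cmod k + 1)) * (Cmod k + 1))%R with (eps / 2)%R in B by (field; lra).
lra.
Qed.

Lemma cvg_opp (u : nat -> C) (l : C) : cvg u l -> cvg (fun n => - u n) (- l).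
Proof.
intros H; apply cvg_ext with (fun n => RtoC (-1) * u n); [intros; ring|].
replace (- l) with (RtoC (-1) * l) by ring.
apply cvg_mult; [apply cvg_const|exact H].
Qed.

Lemma cvg_minus (u v : nat -> C) (l k : C) :
  cvg u l -> cvg v k -> cvg (fun n => u n - v n) (l - k).
Proof. intros H H'; apply cvg_plus; [exact H|apply cvg_opp, H']. Qed.

Lemma cvg_inv (u : nat -> C) (l : C) : l <> 0 -> cvg u l -> cvg (fun n => / u n) (/ l).
Proof.
intros Hl H eps He.
pose proof (proj1 (Cmod_gt_0 l) Hl) as Hl0.
destruct (H (Cmod l / 2)%R ltac:(lra)) as [N HN].
destruct (H (eps * (Cmod l * Cmod l / 2))%R) as [N' HN'].
{ apply Rmult_lt_0_compat; [lra|]; apply Rmult_lt_0_compat; nra. }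
exists (N + N')%nat; intros n Hn.
specialize (HN n ltac:(lia)); specialize (HN' n ltac:(lia)).
assert (Hu : (Cmod l / 2 < Cmod (u n))%R).
{ rewrite Cmod_sym in HN; pose proof (Cmod_sub_ge l (u n)); lra. }
assert (Hun : u n <> 0) by (apply Cmod_gt_0; lra).
replace (/ u n - / l) with ((l - u n) / (u n * l)) by (field; auto).
rewrite Cmod_div, Cmod_mult, Cmod_sym by (apply Cmult_neq_0; assumption).
apply Rmult_lt_reg_r with (Cmod (u n) * Cmod l)%R; [apply Rmult_lt_0_compat; lra|].
unfold Rdiv; rewrite Rmult_assoc, Rinv_l, Rmult_1_r by (apply Rgt_not_eq, Rmult_lt_0_compat; lra).
apply Rlt_le_trans with (1 := HN').
apply Rmult_le_compat_l; [lra|]; nra.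
Qed.

Lemma cvg_div (u v : nat -> C) (l k : C) :
  k <> 0 -> cvg u l -> cvg v k -> cvg (fun n => u n / v n) (l / k).
Proof. intros Hk H H'; apply cvg_mult; [exact H|apply cvg_inv; assumption]. Qed.

Lemma cvg_subseq (u : nat -> C) (l : C) (phi : nat -> nat) :
  (forall A, exists N, forall n, (N <= n)%nat -> (A <= phi n)%nat) ->
  cvg u l -> cvg (fun n => u (phi n)) l.
Proof.
intros Hphi H eps He; destruct (H eps He) as [N HN]; destruct (Hphi N) as [N' HN'].
exists N'; intros n Hn; apply HN, HN', Hn.
Qed.

Lemma cvg_pair (f g : nat -> R) (x y : R) :
  is_lim_seq f x -> is_lim_seq g y -> cvg (fun n => (f n, g n)) (x, y).
Proof.
intros Hf Hg eps He.
apply is_lim_seq_spec in Hf; apply is_lim_seq_spec in Hg.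
destruct (Hf (mkposreal (eps / 2) ltac:(lra))) as [N HN].
destruct (Hg (mkposreal (eps / 2) ltac:(lra))) as [N' HN'].
exists (N + N')%nat; intros n Hn.
specialize (HN n ltac:(lia)); specialize (HN' n ltac:(lia)); simpl in HN, HN'.
apply Rle_lt_trans with (1 := Cmod_2Rmax _); simpl.
assert (S2 : (sqrt 2 < 2)%R).
{ rewrite <- (sqrt_square 2) at 2 by lra; apply sqrt_lt_1; lra. }
pose proof (sqrt_lt_R0 2 ltac:(lra)).
change (f n + - x)%R with (f n - x)%R; change (g n + - y)%R with (g n - y)%R.
assert (M : (Rmax (Rabs (f n - x)) (Rabs (g n - y)) < eps / 2)%R) by (apply Rmax_lub_lt; assumption).
assert (0 <= Rmax (Rabs (f n - x)) (Rabs (g n - y)))%R.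
{ apply Rle_trans with (2 := Rmax_l _ _), Rabs_pos. }
nra.
Qed.

Lemma cvg_RtoC (f : nat -> R) (x : R) :
  is_lim_seq f x -> cvg (fun n => RtoC (f n)) (RtoC x).
Proof. intros H; apply cvg_pair; [exact H|apply is_lim_seq_const]. Qed.

Lemma cvg_le (u : nat -> C) (l : C) (B : R) :
  cvg u l -> (forall n, (Cmod (u n) <= B)%R) -> (Cmod l <= B)%R.
Proof.
intros H HB; apply Rnot_lt_le; intros Hlt.
destruct (H (Cmod l - B)%R ltac:(lra)) as [N HN].
specialize (HN N (le_n N)); rewrite Cmod_sym in HN.
pose proof (Cmod_sub_ge l (u N)); pose proof (HB N); lra.
Qed.

Lemma cvg_0_le (u : nat -> C) (f : nat -> R) :
  (forall n, (Cmod (u n) <= f n)%R) -> is_lim_seq f 0%R -> cvg u 0.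
Proof.
intros H Hf eps He; apply is_lim_seq_spec in Hf.
destruct (Hf (mkposreal eps He)) as [N HN]; exists N; intros n Hn.
specialize (HN n Hn); simpl in HN; rewrite Rminus_0_r in HN.
replace (u n - 0) with (u n) by ring.
apply Rle_lt_trans with (1 := H n), Rle_lt_trans with (2 := HN), Rle_abs.
Qed.

(** The upper bound is excluded and the empty sum is 0, so that truncations at n have n terms and
    split without offset; [sum_n] is one term longer. *)
Fixpoint csum (f : nat -> C) (n : nat) : C :=
  match n with O => 0 | S k => csum f k + f k end.

Lemma csum_ext (f g : nat -> C) (n : nat) :
  (forall k, (k < n)%nat -> f k = g k) -> csum f n = csum g n.
Proof.
induction n as [|n IH]; intros H; simpl; [reflexivity|].
rewrite IH, H; auto.
Qed.

Lemma csum_plus (f g : nat -> C) (n : nat) :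
  csum (fun k => f k + g k) n = csum f n + csum g n.
Proof. induction n as [|n IH]; simpl; [|rewrite IH]; ring. Qed.

Lemma csum_scal (c : C) (f : nat -> C) (n : nat) :
  csum (fun k => c * f k) n = c * csum f n.
Proof. induction n as [|n IH]; simpl; [|rewrite IH]; ring. Qed.

Lemma csum_opp (f : nat -> C) (n : nat) : csum (fun k => - f k) n = - csum f n.
Proof. induction n as [|n IH]; simpl; [|rewrite IH]; ring. Qed.

Lemma csum_minus (f g : nat -> C) (n : nat) :
  csum (fun k => f k - g k) n = csum f n - csum g n.
Proof. induction n as [|n IH]; simpl; [|rewrite IH]; ring. Qed.

Lemma csum_add (f : nat -> C) (n m : nat) :
  csum f (n + m) = csum f n + csum (fun k => f (n + k)%nat) m.
Proof.
induction m as [|m IH]; simpl; [rewrite Nat.add_0_r; ring|].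
rewrite Nat.add_succ_r; simpl; rewrite IH; ring.
Qed.

Lemma csum_S_l (f : nat -> C) (n : nat) :
  csum f (S n) = f O + csum (fun k => f (S k)) n.
Proof. change (S n) with (1 + n)%nat; rewrite csum_add; simpl; ring. Qed.

Lemma csum_rev (f : nat -> C) (n : nat) :
  csum f n = csum (fun k => f (n - 1 - k)%nat) n.
Proof.
revert f; induction n as [|n IH]; intros f; [reflexivity|].
rewrite csum_S_l, IH; simpl.
rewrite Nat.sub_0_r, Nat.sub_diag, Cplus_comm; f_equal.
apply csum_ext; intros k Hk; f_equal; lia.
Qed.

Lemma csum_pairs (f : nat -> C) (n : nat) :
  csum f (2 * n) = csum (fun k => f (2 * k)%nat + f (S (2 * k))) n.
Proof.
induction n as [|n IH]; [reflexivity|].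
replace (2 * S n)%nat with (S (S (2 * n))) by lia; cbn [csum]; rewrite IH; ring.
Qed.

Lemma csum_zero (f : nat -> C) (n : nat) : (forall k, f k = 0) -> csum f n = 0.
Proof. intros H; induction n as [|n IH]; simpl; [|rewrite IH, H]; ring. Qed.

Lemma sum_n_csum (f : nat -> C) (n : nat) :
  sum_n (G := C_AbelianMonoid) f n = csum f (S n).
Proof.
induction n as [|n IH]; [rewrite sum_O; simpl; ring|].
rewrite sum_Sn, IH; reflexivity.
Qed.

Lemma is_series_of_cvg (f : nat -> C) (l : C) :
  cvg (csum f) l -> is_series (K := C_AbsRing) (V := C_NormedModule) f l.
Proof.
intros H P [eps HP].
destruct (H eps (cond_pos eps)) as [N HN]; exists N; intros n Hn.
apply HP; apply C_NormedModule_mixin_compat1.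
rewrite sum_n_csum; apply HN; lia.
Qed.

(* Telescoping [1/(k+1)^2 <= 1/k - 1/(k+1)]. *)
Lemma csum_tail_bound (f : nat -> C) (c : R) (K d : nat) :
  (0 <= c)%R -> (0 < K)%nat ->
  (forall k, (K <= k < K + d)%nat -> Cmod (f k) <= c / INR (S k) ^ 2)%R ->
  (Cmod (csum f (K + d) - csum f K) <= c * (/ INR K - / INR (K + d)))%R.
Proof.
intros Hc HK; induction d as [|d IH]; intros H.
- rewrite Nat.add_0_r; replace (csum f K - csum f K) with (RtoC 0) by ring.
  rewrite Cmod_0; lra.
- rewrite Nat.add_succ_r; cbn [csum].
  replace (csum f (K + d) + f (K + d)%nat - csum f K)
    with ((csum f (K + d) - csum f K) + f (K + d)%nat) by ring.
  pose proof (Cmod_triangle (csum f (K + d) - csum f K) (f (K + d)%nat)).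
  specialize (IH ltac:(intros k Hk; apply H; lia)).
  specialize (H (K + d)%nat ltac:(lia)).
  assert (HKd : (0 < INR (K + d))%R) by (apply lt_0_INR; lia).
  enough (c / INR (S (K + d)) ^ 2 <= c * (/ INR (K + d) - / INR (S (K + d))))%R by lra.
  apply Rmult_le_compat_l; [exact Hc|].
  rewrite S_INR; set (x := INR (K + d)) in *.
  replace (/ x - / (x + 1))%R with (/ (x * (x + 1)))%R by (field; lra).
  apply Rinv_le_contravar; nra.
Qed.

Lemma csum_tail_bound' (f : nat -> C) (c : R) (K n : nat) :
  (0 <= c)%R -> (0 < K <= n)%nat ->
  (forall k, (K <= k < n)%nat -> Cmod (f k) <= c / INR (S k) ^ 2)%R ->
  (Cmod (csum f n - csum f K) <= c / INR K)%R.
Proof.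
intros Hc HK H; replace n with (K + (n - K))%nat by lia.
apply Rle_trans with (c * (/ INR K - / INR (K + (n - K))))%R.
- apply csum_tail_bound; [exact Hc|lia|intros k Hk; apply H; lia].
- apply Rmult_le_compat_l; [exact Hc|].
  assert (0 < / INR (K + (n - K)))%R by (apply Rinv_0_lt_compat, lt_0_INR; lia); lra.
Qed.

(** The factor 2 is c for the first term plus c for the telescoped tail from index 1 on. *)
Lemma csum_bound (f : nat -> C) (c : R) (n : nat) :
  (forall k, Cmod (f k) <= c / INR (S k) ^ 2)%R -> (Cmod (csum f n) <= 2 * c)%R.
Proof.
intros H.
assert (H0 := H O); simpl in H0.
assert (Hc : (0 <= c)%R) by (pose proof (Cmod_ge_0 (f O)); lra).
destruct n as [|n]; [simpl; rewrite Cmod_0; lra|].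
pose proof (csum_tail_bound' f c 1 (S n) Hc ltac:(lia) (fun k _ => H k)) as T.
replace (csum f 1) with (f O) in T by (simpl; ring).
pose proof (Cmod_sub_ge (csum f (S n)) (f O)); simpl INR in T; lra.
Qed.

Lemma exists_inv_lt (c eps : R) (N : nat) : (0 < eps)%R ->
  exists K, (0 < K)%nat /\ (N <= K)%nat /\ (c / INR K < eps)%R.
Proof.
intros He.
destruct (INR_unbounded (Rabs c / eps)) as [K HK].
exists (S (K + N)); split; [lia|split; [lia|]].
assert (HK0 : (INR K <= INR (S (K + N)))%R) by (apply le_INR; lia).
assert (0 < INR (S (K + N)))%R by (apply lt_0_INR; lia).
apply Rmult_lt_reg_r with (INR (S (K + N))); [assumption|].
unfold Rdiv; rewrite Rmult_assoc, Rinv_l, Rmult_1_r by lra.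
apply Rle_lt_trans with (Rabs c); [apply Rle_abs|].
apply Rlt_div_l in HK; [|exact He]; nra.
Qed.

Lemma csum_cvg_of_bound (f : nat -> C) (c : R) :
  (forall k, Cmod (f k) <= c / INR (S k) ^ 2)%R -> exists l, cvg (csum f) l.
Proof.
intros H.
assert (H0 := H O); simpl in H0.
assert (Hc : (0 <= c)%R) by (pose proof (Cmod_ge_0 (f O)); lra).
assert (G : exists l, is_lim_seq (fun n => Re (csum f n)) (Finite l)).
2: assert (G' : exists l, is_lim_seq (fun n => Im (csum f n)) (Finite l)).
3: { destruct G as [x Hx], G' as [y Hy]; exists (x, y).
     apply cvg_ext with (2 := cvg_pair _ _ _ _ Hx Hy).
     intros n; destruct (csum f n); reflexivity. }
all: apply ex_lim_seq_cauchy_corr; intros eps;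
  destruct (exists_inv_lt c (eps / 2) O) as (K & HK & _ & HK'); [destruct eps; simpl; lra|];
  exists K; intros n m Hn Hm;
  pose proof (csum_tail_bound' f c K n Hc ltac:(lia) (fun k _ => H k));
  pose proof (csum_tail_bound' f c K m Hc ltac:(lia) (fun k _ => H k)) as Hm';
  pose proof (Cmod_sub_triangle (csum f n) (csum f K) (csum f m)) as T;
  rewrite (Cmod_sym (csum f m)) in Hm';
  pose proof (Rmax_Cmod (csum f n - csum f m)) as X; simpl in X.
- pose proof (Rle_trans _ _ _ (Rmax_l _ _) X); unfold Re; unfold Rminus; lra.
- pose proof (Rle_trans _ _ _ (Rmax_r _ _) X); unfold Im; unfold Rminus; lra.
Qed.

Lemma tannery_partial (f : nat -> nat -> C) (g : nat -> C) (K : nat) :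
  (forall k, cvg (fun n => f n k) (g k)) -> cvg (fun n => csum (f n) K) (csum g K).
Proof.
intros H; induction K as [|K IH]; simpl; [apply cvg_const|apply cvg_plus; auto].
Qed.

(** Dominated convergence for sums of growing length, used to find the value of the limit series: l
    is known as the limit of the finite sums. [csum g K] is compared with [csum (f n) K] by termwise
    convergence, that with [csum (f n) (M n)] by the tail bound c / K, and the latter with l, each
    within eps / 3. *)
Lemma tannery (f : nat -> nat -> C) (g : nat -> C) (M : nat -> nat) (c : R)
  (k0 n0 : nat) (l : C) :
  (forall A, exists N, forall n, (N <= n)%nat -> (A <= M n)%nat) ->
  (forall n k, (n0 <= n)%nat -> (k0 <= k < M n)%nat -> Cmod (f n k) <= c / INR (S k) ^ 2)%R ->
  (forall k, cvg (fun n => f n k) (g k)) ->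
  cvg (fun n => csum (f n) (M n)) l -> cvg (csum g) l.
Proof.
intros HM Hb Hg Hl.
(* Since [M n] eventually exceeds [k0], the bound applies to at least one modulus, which forces c to
   be nonnegative. *)
assert (Hc : (0 <= c)%R).
{ destruct (HM (S k0)) as [N HN].
  specialize (HN (N + n0)%nat ltac:(lia)).
  specialize (Hb (N + n0)%nat k0 ltac:(lia) ltac:(lia)).
  pose proof (Cmod_ge_0 (f (N + n0)%nat k0)).
  assert (0 < INR (S k0))%R by (apply lt_0_INR; lia).
  apply Rnot_lt_le; intros Hc.
  assert (c / INR (S k0) ^ 2 < 0)%R; [|lra].
  apply Rmult_neg_pos; [exact Hc|apply Rinv_0_lt_compat, pow_lt; assumption]. }
intros eps He.
destruct (exists_inv_lt c (eps / 3) k0) as (K0 & HK0 & Hk0 & HKe); [lra|].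
exists K0; intros K HK.
destruct (tannery_partial f g K Hg (eps / 3)%R ltac:(lra)) as [N1 HN1].
destruct (Hl (eps / 3)%R ltac:(lra)) as [N2 HN2].
destruct (HM K) as [N3 HN3].
set (n := (N1 + N2 + N3 + n0)%nat).
specialize (HN1 n ltac:(unfold n; lia)); specialize (HN2 n ltac:(unfold n; lia)).
specialize (HN3 n ltac:(unfold n; lia)).
assert (T : (Cmod (csum (f n) (M n) - csum (f n) K) <= c / INR K)%R).
{ apply csum_tail_bound'; [exact Hc|lia|].
  intros k Hk; apply Hb; [unfold n; lia|lia]. }
assert (c / INR K <= c / INR K0)%R.
{ apply Rmult_le_compat_l; [exact Hc|].
  apply Rinv_le_contravar; [apply lt_0_INR; lia|apply le_INR; lia]. }
pose proof (Cmod_sub_triangle (csum g K) (csum (f n) K) l) as T1.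
pose proof (Cmod_sub_triangle (csum (f n) K) (csum (f n) (M n)) l) as T2.
rewrite (Cmod_sym (csum g K) (csum (f n) K)) in T1.
rewrite (Cmod_sym (csum (f n) K) (csum (f n) (M n))) in T2.
lra.
Qed.

(** * Complex sine and cosine *)

Lemma RtoC_neq_0 (x : R) : x <> 0%R -> RtoC x <> 0.
Proof. intros H E; apply H, RtoC_inj, E. Qed.

Lemma C2_neq_0 : RtoC 2 <> 0.
Proof. apply RtoC_neq_0; lra. Qed.

Ltac cnz := repeat split; first [exact Ci_nz | exact C2_neq_0 | assumption].

Lemma Cexp_plus (z w : C) : Cexp (z + w) = Cexp z * Cexp w.
Proof.
destruct z as [a b], w as [c d]; unfold Cexp; simpl.
rewrite exp_plus, cos_plus, sin_plus.
unfold Cmult, RtoC; simpl; f_equal; ring.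
Qed.

Lemma Cexp_0 : Cexp 0 = 1.
Proof.
unfold Cexp; simpl; rewrite exp_0, cos_0, sin_0.
unfold Cmult, RtoC; simpl; f_equal; ring.
Qed.

Lemma Ci_sqr : Ci * Ci = - (1).
Proof. unfold Ci, Cmult, Copp, RtoC; simpl; f_equal; ring. Qed.

(** With [Ci] in the numerator, a product of two sines displays the factor [Ci * Ci], which [Ci_sqr]
    evaluates; the [field] tactic treats [Ci] as an indeterminate. *)
Lemma Csin_alt (z : C) : Csin z = Ci * (Cexp (- (Ci * z)) - Cexp (Ci * z)) / 2.
Proof.
unfold Csin.
set (E := Cexp (Ci * z)); set (E' := Cexp (- (Ci * z))).
replace (Ci * (E' - E) / 2) with ((- (Ci * Ci)) * (E - E') / (2 * Ci)).
- rewrite Ci_sqr; field; cnz.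
- field; cnz.
Qed.

Lemma Csin_plus (z w : C) : Csin (z + w) = Csin z * Ccos w + Ccos z * Csin w.
Proof.
unfold Csin, Ccos.
replace (- (Ci * (z + w))) with (- (Ci * z) + - (Ci * w)) by ring.
replace (Ci * (z + w)) with (Ci * z + Ci * w) by ring.
rewrite !Cexp_plus; field; cnz.
Qed.

Lemma Ccos_plus (z w : C) : Ccos (z + w) = Ccos z * Ccos w - Csin z * Csin w.
Proof.
rewrite !Csin_alt; unfold Ccos.
replace (- (Ci * (z + w))) with (- (Ci * z) + - (Ci * w)) by ring.
replace (Ci * (z + w)) with (Ci * z + Ci * w) by ring.
rewrite !Cexp_plus.
set (E := Cexp (Ci * z)); set (E' := Cexp (- (Ci * z))).
set (F := Cexp (Ci * w)); set (F' := Cexp (- (Ci * w))).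
transitivity ((E + E') / 2 * ((F + F') / 2) - (Ci * Ci) * (E' - E) * (F' - F) / (2 * 2)).
- rewrite Ci_sqr; field; cnz.
- field; cnz.
Qed.

Lemma Csin_opp (z : C) : Csin (- z) = - Csin z.
Proof.
unfold Csin; replace (- (Ci * - z)) with (Ci * z) by ring.
replace (Ci * - z) with (- (Ci * z)) by ring.
field; cnz.
Qed.

Lemma Ccos_opp (z : C) : Ccos (- z) = Ccos z.
Proof.
unfold Ccos; replace (- (Ci * - z)) with (Ci * z) by ring.
replace (Ci * - z) with (- (Ci * z)) by ring.
field; cnz.
Qed.

Lemma Csin2_Ccos2 (z : C) : Csin z * Csin z + Ccos z * Ccos z = 1.
Proof.
assert (H := Ccos_plus z (- z)).
rewrite Csin_opp, Ccos_opp in H.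
replace (Csin z * Csin z + Ccos z * Ccos z) with (Ccos z * Ccos z - Csin z * - Csin z) by ring.
rewrite <- H; unfold Ccos.
replace (Ci * (z + - z)) with (RtoC 0) by ring.
replace (- RtoC 0) with (RtoC 0) by ring.
rewrite Cexp_0; field; cnz.
Qed.

Lemma Csin_re_im (x y : R) : Csin (x, y) = (sin x * cosh y, cos x * sinh y)%R.
Proof.
rewrite Csin_alt; unfold Cexp, cosh, sinh; simpl.
replace (0 * x - 1 * y)%R with (- y)%R by ring.
replace (0 * y + 1 * x)%R with x by ring.
rewrite Ropp_involutive, cos_neg, sin_neg.
unfold Ci, Cdiv, Cinv, Cmult, Cminus, Cplus, Copp, RtoC; simpl; f_equal; field.
Qed.

Lemma Ccos_re_im (x y : R) : Ccos (x, y) = (cos x * cosh y, - (sin x * sinh y))%R.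
Proof.
unfold Ccos, Cexp, cosh, sinh; simpl.
replace (0 * x - 1 * y)%R with (- y)%R by ring.
replace (0 * y + 1 * x)%R with x by ring.
rewrite Ropp_involutive, cos_neg, sin_neg.
unfold Ci, Cdiv, Cinv, Cmult, Cminus, Cplus, Copp, RtoC; simpl; f_equal; field.
Qed.

Lemma sinh_0 : sinh 0 = 0%R.
Proof. unfold sinh; rewrite Ropp_0; lra. Qed.

Lemma Csin_RtoC (x : R) : Csin (RtoC x) = RtoC (sin x).
Proof.
unfold RtoC; rewrite Csin_re_im, cosh_0, sinh_0; f_equal; ring.
Qed.

Lemma Ccos_RtoC (x : R) : Ccos (RtoC x) = RtoC (cos x).
Proof.
unfold RtoC; rewrite Ccos_re_im, cosh_0, sinh_0; f_equal; ring.
Qed.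

Lemma cosh2_sinh2 (y : R) : (cosh y ^ 2 = 1 + sinh y ^ 2)%R.
Proof.
unfold cosh, sinh.
assert (E : (exp y * exp (- y) = 1)%R) by (rewrite <- exp_plus, Rplus_opp_r; apply exp_0).
nra.
Qed.

(** The mean value theorem with cosh >= 1 gives t <= sinh t for t >= 0; oddness covers negative
    y. *)
Lemma sinh_sqr_ge (y : R) : (y ^ 2 <= sinh y ^ 2)%R.
Proof.
assert (P : forall t, (0 <= t)%R -> (t <= sinh t)%R).
{ intros t Ht.
  destruct (MVT_gen sinh 0 t cosh) as (c & Hc & E').
  - intros x _; apply is_derive_Reals, derivable_pt_lim_sinh.
  - intros x _; apply derivable_continuous_pt; exists (cosh x); apply derivable_pt_lim_sinh.
  - rewrite sinh_0 in E'.
    assert (1 <= cosh c)%R.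
    { pose proof (cosh2_sinh2 c); assert (0 < cosh c)%R.
      { unfold cosh; pose proof (exp_pos c); pose proof (exp_pos (- c)); lra. }
      nra. }
    nra. }
destruct (Rle_dec 0 y) as [Hy|Hy].
- specialize (P y Hy); nra.
- specialize (P (- y)%R ltac:(lra)).
  assert (E : sinh (- y) = (- sinh y)%R) by (unfold sinh; rewrite Ropp_involutive; lra).
  rewrite E in P; nra.
Qed.

Lemma Cmod_Csin_sqr (x y : R) : (Cmod (Csin (x, y)) ^ 2 = sin x ^ 2 + sinh y ^ 2)%R.
Proof.
rewrite Csin_re_im, Cmod2_alt; simpl Re; simpl Im.
pose proof (cosh2_sinh2 y) as H; pose proof (sin2_cos2 x) as H'; unfold Rsqr in H'.
replace ((sin x * cosh y) ^ 2)%R with (sin x ^ 2 * cosh y ^ 2)%R by ring.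
rewrite H; replace ((cos x * sinh y) ^ 2)%R with ((cos x * cos x) * sinh y ^ 2)%R by ring.
replace (cos x * cos x)%R with (1 - sin x * sin x)%R by lra; ring.
Qed.

Lemma Cmod_Ccos_sqr (x y : R) : (Cmod (Ccos (x, y)) ^ 2 = cos x ^ 2 + sinh y ^ 2)%R.
Proof.
rewrite Ccos_re_im, Cmod2_alt; simpl Re; simpl Im.
pose proof (cosh2_sinh2 y) as H; pose proof (sin2_cos2 x) as H'; unfold Rsqr in H'.
replace ((cos x * cosh y) ^ 2)%R with (cos x ^ 2 * cosh y ^ 2)%R by ring.
rewrite H; replace ((- (sin x * sinh y)) ^ 2)%R with ((sin x * sin x) * sinh y ^ 2)%R by ring.
replace (sin x * sin x)%R with (1 - cos x * cos x)%R by lra; ring.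
Qed.

(** Follows from |cos z|^2 = cos^2 x + sinh^2 y. This linear bound serves twice: cosines do not
    vanish off the real axis, and the secants in psi are bounded by 1 / |Im w|. *)
Lemma Cmod_Ccos_ge (z : C) : (Rabs (Im z) <= Cmod (Ccos z))%R.
Proof.
destruct z as [x y]; simpl Im.
apply Rsqr_incr_0_var; [|apply Cmod_ge_0].
rewrite <- Rsqr_abs; unfold Rsqr.
pose proof (Cmod_Ccos_sqr x y); pose proof (sinh_sqr_ge y); pose proof (pow2_ge_0 (cos x)); nra.
Qed.

Lemma Cmod_Csin_ge (z : C) : (Rabs (Im z) <= Cmod (Csin z))%R.
Proof.
destruct z as [x y]; simpl Im.
apply Rsqr_incr_0_var; [|apply Cmod_ge_0].
rewrite <- Rsqr_abs; unfold Rsqr.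
pose proof (Cmod_Csin_sqr x y); pose proof (sinh_sqr_ge y); pose proof (pow2_ge_0 (sin x)); nra.
Qed.

Lemma Ccos_neq_0_of_Im (z : C) : Im z <> 0%R -> Ccos z <> 0.
Proof.
intros H E; pose proof (Cmod_Ccos_ge z) as G; rewrite E, Cmod_0 in G.
pose proof (Rabs_pos_lt _ H); lra.
Qed.

Lemma Csin_neq_0_of_Im (z : C) : Im z <> 0%R -> Csin z <> 0.
Proof.
intros H E; pose proof (Cmod_Csin_ge z) as G; rewrite E, Cmod_0 in G.
pose proof (Rabs_pos_lt _ H); lra.
Qed.

Lemma Ccos_neq_0_of_small (z : C) : (Cmod z < 1)%R -> Ccos z <> 0.
Proof.
intros H; destruct (Req_dec (Im z) 0) as [E|E]; [|apply Ccos_neq_0_of_Im, E].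
destruct z as [x y]; simpl in E; subst y.
change (x, 0%R) with (RtoC x) in *; rewrite Ccos_RtoC; rewrite Cmod_R in H.
apply RtoC_neq_0, Rgt_not_eq; apply Rabs_def2 in H; pose proof PI2_1.
apply cos_gt_0; lra.
Qed.

Lemma Csin_neq_0_of_small (z : C) : z <> 0 -> (Cmod z < 1)%R -> Csin z <> 0.
Proof.
intros Hz H; destruct (Req_dec (Im z) 0) as [E|E]; [|apply Csin_neq_0_of_Im, E].
destruct z as [x y]; simpl in E; subst y.
change (x, 0%R) with (RtoC x) in *; rewrite Csin_RtoC; rewrite Cmod_R in H.
apply RtoC_neq_0; apply Rabs_def2 in H; pose proof PI2_1.
destruct (Rtotal_order x 0) as [L|[L|L]].
- apply Rlt_not_eq, sin_lt_0_var; lra.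
- subst x; exfalso; apply Hz; reflexivity.
- apply Rgt_not_eq, sin_gt_0; lra.
Qed.

Lemma Csin_PI2 : Csin (RtoC (PI / 2)) = 1.
Proof. rewrite Csin_RtoC, sin_PI2; reflexivity. Qed.

Lemma Ccos_PI2 : Ccos (RtoC (PI / 2)) = 0.
Proof. rewrite Ccos_RtoC, cos_PI2; reflexivity. Qed.

Lemma Csin_plus_PI2 (z : C) : Csin (z + RtoC (PI / 2)) = Ccos z.
Proof. rewrite Csin_plus, Csin_PI2, Ccos_PI2; ring. Qed.

Lemma Ccos_plus_PI2 (z : C) : Ccos (z + RtoC (PI / 2)) = - Csin z.
Proof. rewrite Ccos_plus, Csin_PI2, Ccos_PI2; ring. Qed.

Lemma Csin_plus_PI (z : C) : Csin (z + RtoC PI) = - Csin z.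
Proof.
replace (z + RtoC PI) with (z + RtoC (PI / 2) + RtoC (PI / 2)).
- rewrite Csin_plus_PI2, Ccos_plus_PI2; reflexivity.
- rewrite <- Cplus_assoc, <- RtoC_plus; f_equal; f_equal; field.
Qed.

Lemma Ccos_plus_PI (z : C) : Ccos (z + RtoC PI) = - Ccos z.
Proof.
replace (z + RtoC PI) with (z + RtoC (PI / 2) + RtoC (PI / 2)).
- rewrite Ccos_plus_PI2, Csin_plus_PI2; reflexivity.
- rewrite <- Cplus_assoc, <- RtoC_plus; f_equal; f_equal; field.
Qed.

Definition sgn (k : nat) : C := RtoC ((-1) ^ k).

Lemma sgn_S (k : nat) : sgn (S k) = - sgn k.
Proof.
unfold sgn; rewrite <- RtoC_opp; f_equal; simpl; ring.
Qed.

Lemma sgn_sqr (k : nat) : sgn k * sgn k = 1.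
Proof.
induction k as [|k IH]; [unfold sgn; simpl; ring|].
rewrite sgn_S; replace (- sgn k * - sgn k) with (sgn k * sgn k) by ring; exact IH.
Qed.

Lemma sgn_double (k : nat) : sgn (2 * k) = 1.
Proof. unfold sgn; rewrite pow_1_even; reflexivity. Qed.

Lemma Cmod_sgn (k : nat) : Cmod (sgn k) = 1%R.
Proof. unfold sgn; rewrite Cmod_R; apply pow_1_abs. Qed.

Lemma sgn_neq_0 (k : nat) : sgn k <> 0.
Proof. apply Cmod_gt_0; rewrite Cmod_sgn; lra. Qed.

Lemma Csin_plus_nPI (z : C) (k : nat) :
  Csin (z + RtoC (INR k * PI)) = sgn k * Csin z.
Proof.
induction k as [|k IH].
- unfold sgn; simpl; rewrite Rmult_0_l, Cplus_0_r; ring.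
- replace (z + RtoC (INR (S k) * PI)) with (z + RtoC (INR k * PI) + RtoC PI).
  + rewrite Csin_plus_PI, IH, sgn_S; ring.
  + rewrite <- Cplus_assoc, <- RtoC_plus, S_INR; do 2 f_equal; ring.
Qed.

Lemma Ccos_plus_nPI (z : C) (k : nat) :
  Ccos (z + RtoC (INR k * PI)) = sgn k * Ccos z.
Proof.
induction k as [|k IH].
- unfold sgn; simpl; rewrite Rmult_0_l, Cplus_0_r; ring.
- replace (z + RtoC (INR (S k) * PI)) with (z + RtoC (INR k * PI) + RtoC PI).
  + rewrite Ccos_plus_PI, IH, sgn_S; ring.
  + rewrite <- Cplus_assoc, <- RtoC_plus, S_INR; do 2 f_equal; ring.
Qed.

(** * A finite partial fraction identity for the cosecant *)

Definition Ccot (z : C) : C := Ccos z / Csin z.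

Lemma Csin_double (z : C) : Csin (2 * z) = 2 * (Csin z * Ccos z).
Proof. replace (2 * z) with (z + z) by ring; rewrite Csin_plus; ring. Qed.

Lemma Ccos_double (z : C) : Ccos (2 * z) = 1 - 2 * (Csin z * Csin z).
Proof.
replace (2 * z) with (z + z) by ring; rewrite Ccos_plus, <- (Csin2_Ccos2 z); ring.
Qed.

Lemma half_angle_neq_0 (y : C) : Csin y <> 0 ->
  Csin (y / 2) <> 0 /\ Csin ((y + RtoC PI) / 2) <> 0.
Proof.
intros H.
replace ((y + RtoC PI) / 2) with (y / 2 + RtoC (PI / 2))
  by (rewrite RtoC_div by lra; field; cnz).
rewrite Csin_plus_PI2.
replace y with (2 * (y / 2)) in H by (field; cnz); rewrite Csin_double in H.
split; intros E; apply H; rewrite E; ring.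
Qed.

(** Since cot ((y + PI) / 2) = - tan (y / 2), both are double angle formulas. The first can be
    iterated; the second is used once, to pass from the cosecant to cotangents. *)
Lemma Ccot_half (y : C) : Csin y <> 0 ->
  Ccot (y / 2) + Ccot ((y + RtoC PI) / 2) = 2 * Ccot y /\
  Ccot (y / 2) - Ccot ((y + RtoC PI) / 2) = 2 / Csin y.
Proof.
intros H; destruct (half_angle_neq_0 y H) as [H1 H2]; unfold Ccot.
replace ((y + RtoC PI) / 2) with (y / 2 + RtoC (PI / 2)) in *
  by (rewrite RtoC_div by lra; field; cnz).
rewrite Csin_plus_PI2 in *; rewrite Ccos_plus_PI2.
assert (Es : Csin y = 2 * (Csin (y / 2) * Ccos (y / 2))).
{ rewrite <- Csin_double; f_equal; field; cnz. }
assert (Ec : Ccos y = Ccos (y / 2) * Ccos (y / 2) - Csin (y / 2) * Csin (y / 2)).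
{ rewrite <- Ccos_plus; f_equal; field; cnz. }
rewrite Es, Ec.
split.
- field; cnz.
- transitivity (2 * (Csin (y / 2) * Csin (y / 2) + Ccos (y / 2) * Ccos (y / 2))
    / (2 * (Csin (y / 2) * Ccos (y / 2)))); [field; cnz|].
  rewrite Csin2_Ccos2; field; cnz.
Qed.

Definition Cpow2 (n : nat) : C := RtoC (2 ^ n).

Lemma Cpow2_S (n : nat) : Cpow2 (S n) = 2 * Cpow2 n.
Proof. unfold Cpow2; rewrite <- RtoC_mult; reflexivity. Qed.

Lemma Cpow2_neq_0 (n : nat) : Cpow2 n <> 0.
Proof. apply RtoC_neq_0, pow_nonzero; lra. Qed.

Lemma nPI_double (k : nat) :
  RtoC (INR (2 * k) * PI) = 2 * RtoC (INR k * PI) /\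
  RtoC (INR (S (2 * k)) * PI) = RtoC PI + 2 * RtoC (INR k * PI).
Proof.
rewrite <- !RtoC_mult, <- RtoC_plus, S_INR, mult_INR; simpl INR.
split; f_equal; ring.
Qed.

(** Induction by parity of k: the even indices form the sum at level n for y / 2, the odd ones that
    for (y + PI) / 2. *)
Lemma Ccot_sum (n : nat) : forall y : C, Csin y <> 0 ->
  csum (fun k => Ccot ((y + RtoC (INR k * PI)) / Cpow2 n)) (2 ^ n) = Cpow2 n * Ccot y.
Proof.
induction n as [|n IH]; intros y Hy.
- unfold Cpow2; simpl; rewrite Rmult_0_l.
  replace ((y + 0) / 1) with y by (field; apply C1_nz); ring.
- rewrite Nat.pow_succ_r', csum_pairs, csum_plus.
  destruct (half_angle_neq_0 y Hy) as [H1 H2], (Ccot_half y Hy) as [E _].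
  pose proof (Cpow2_neq_0 n).
  transitivity (Cpow2 n * Ccot (y / 2) + Cpow2 n * Ccot ((y + RtoC PI) / 2)).
  2: { rewrite <- Cmult_plus_distr_l, E, Cpow2_S; ring. }
  rewrite <- (IH _ H1), <- (IH _ H2).
  f_equal; apply csum_ext; intros k _; f_equal; rewrite Cpow2_S;
    destruct (nPI_double k) as [E1 E2]; rewrite ?E1, ?E2; field; cnz.
Qed.

(** The sign is + on even and - on odd indices, so splitting by parity gives the difference of the
    two cotangent sums for y / 2 and (y + PI) / 2. *)
Lemma csc_sum (n : nat) (y : C) : Csin y <> 0 ->
  csum (fun k => sgn k * Ccot ((y + RtoC (INR k * PI)) / Cpow2 (S n))) (2 * 2 ^ n)
  = Cpow2 (S n) / Csin y.
Proof.
intros Hy; rewrite csum_pairs, csum_plus.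
destruct (half_angle_neq_0 y Hy) as [H1 H2], (Ccot_half y Hy) as [_ E].
pose proof (Cpow2_neq_0 n).
transitivity (Cpow2 n * Ccot (y / 2) - Cpow2 n * Ccot ((y + RtoC PI) / 2)).
2: { transitivity (Cpow2 n * (Ccot (y / 2) - Ccot ((y + RtoC PI) / 2))); [ring|].
     rewrite E, Cpow2_S; field; cnz. }
rewrite <- (Ccot_sum n _ H1), <- (Ccot_sum n _ H2).
unfold Cminus; rewrite <- csum_opp.
f_equal; apply csum_ext; intros k _; rewrite ?sgn_S, sgn_double, Cpow2_S;
  destruct (nPI_double k) as [E1 E2]; rewrite ?E1, ?E2.
- rewrite Cmult_1_l; f_equal; field; cnz.
- transitivity (- Ccot ((y + (RtoC PI + 2 * RtoC (INR k * PI))) / (2 * Cpow2 n))); [ring|].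
  do 2 f_equal; field; cnz.
Qed.

(** Index j is paired with 2(n+1) - j; 0 and n+1 remain alone. In [csc_finite] this brings together
    the poles at j PI and - j PI. *)
Lemma csum_fold (f : nat -> C) (n : nat) :
  csum f (2 * S n) = f O + f (S n) + csum (fun k => f (S k) + f (2 * S n - S k)%nat) n.
Proof.
rewrite csum_plus.
replace (2 * S n)%nat with (S n + S n)%nat at 1 by lia.
rewrite csum_add, !csum_S_l, Nat.add_0_r, (csum_rev (fun k => f (S n + S k)%nat)).
rewrite (csum_ext (fun k => f (S n + S (n - 1 - k))%nat) (fun k => f (2 * S n - S k)%nat)).
- ring.
- intros k Hk; f_equal; lia.
Qed.

Lemma Csin_pow2_mult (n : nat) (v : C) : Csin v = 0 -> Csin (Cpow2 n * v) = 0.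
Proof.
intros H; induction n as [|n IH].
- unfold Cpow2; simpl; rewrite Cmult_1_l; exact H.
- rewrite Cpow2_S, <- Cmult_assoc, Csin_double, IH; ring.
Qed.

Lemma Csin_minus_nPI (z : C) (k : nat) :
  Csin (z - RtoC (INR k * PI)) = sgn k * Csin z.
Proof.
pose proof (Csin_plus_nPI (z - RtoC (INR k * PI)) k) as H.
replace (z - RtoC (INR k * PI) + RtoC (INR k * PI)) with z in H by ring.
rewrite H, Cmult_assoc, sgn_sqr; ring.
Qed.

Lemma Csin_mult_diff (u t : C) :
  Csin (u + t) * Csin (u - t) = Csin u * Csin u - Csin t * Csin t.
Proof.
unfold Cminus at 1; rewrite !Csin_plus, Csin_opp, Ccos_opp.
transitivity (Csin u * Csin u * (Ccos t * Ccos t) - (Ccos u * Ccos u) * (Csin t * Csin t)); [ring|].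
pose proof (Csin2_Ccos2 u) as Hu; pose proof (Csin2_Ccos2 t) as Ht.
replace (Ccos t * Ccos t) with (1 - Csin t * Csin t) by (rewrite <- Ht; ring).
replace (Ccos u * Ccos u) with (1 - Csin u * Csin u) by (rewrite <- Hu; ring).
ring.
Qed.

Lemma Ccot_add_sub (u t : C) : Csin (u + t) <> 0 -> Csin (u - t) <> 0 ->
  Ccot (u + t) + Ccot (u - t) = Csin (2 * u) / (Csin u * Csin u - Csin t * Csin t).
Proof.
intros H1 H2; rewrite <- Csin_mult_diff; unfold Ccot.
replace (2 * u) with ((u + t) + (u - t)) by ring.
rewrite (Csin_plus (u + t) (u - t)); field; cnz.
Qed.

Lemma Ccot_plus_PI (z : C) : Csin z <> 0 -> Ccot (z + RtoC PI) = Ccot z.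
Proof. intros H; unfold Ccot; rewrite Csin_plus_PI, Ccos_plus_PI; field; cnz. Qed.

Definition csc_pole (k : nat) : C := RtoC (INR (S k) * PI).

(* The summands are multiplied through by [Cpow2 (S n) ^ 2] so that each of them
   visibly converges as n grows. *)
Definition csc_finite_term (y : C) (n k : nat) : C :=
  sgn (S k) * (Cpow2 (S n) * Csin (2 * y / Cpow2 (S n))) /
  ((Cpow2 (S n) * Csin (y / Cpow2 (S n))) * (Cpow2 (S n) * Csin (y / Cpow2 (S n)))
   - (Cpow2 (S n) * Csin (csc_pole k / Cpow2 (S n))) * (Cpow2 (S n) * Csin (csc_pole k / Cpow2 (S n)))).

(** [csc_sum] folded: because cot has period PI, index 2^(n+1) - j stands for the pole - j PI, and
    [Ccot_add_sub] merges it with j PI. The two unpaired indices give the two boundary terms, which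
    tend to 1 / y and to 0. *)
Lemma csc_finite (n : nat) (y : C) : Csin y <> 0 ->
  / Csin y = Ccot (y / Cpow2 (S n)) / Cpow2 (S n)
    + sgn (2 ^ n) * Ccot (y / Cpow2 (S n) + RtoC (PI / 2)) / Cpow2 (S n)
    + csum (csc_finite_term y n) (2 ^ n - 1).
Proof.
intros Hy.
pose proof (csc_sum n y Hy) as E.
pose proof (Cpow2_neq_0 (S n)) as HX.
assert (H2n : (2 ^ n <> 0)%nat) by (apply Nat.pow_nonzero; lia).
set (f := fun k => sgn k * Ccot ((y + RtoC (INR k * PI)) / Cpow2 (S n))) in E.
replace (2 ^ n)%nat with (S (2 ^ n - 1)) in E by lia.
rewrite csum_fold in E.
replace (S (2 ^ n - 1)) with (2 ^ n)%nat in E by lia.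
assert (HI : RtoC (INR (2 * 2 ^ n) * PI) = Cpow2 (S n) * RtoC PI).
{ unfold Cpow2; rewrite mult_INR, pow_INR, <- RtoC_mult; reflexivity. }
assert (HI' : RtoC (INR (2 ^ n) * PI) = Cpow2 (S n) * RtoC (PI / 2)).
{ unfold Cpow2; rewrite pow_INR, <- RtoC_mult; f_equal; change (INR 2) with 2%R; simpl; field. }
assert (E0 : f O = Ccot (y / Cpow2 (S n))).
{ unfold f, sgn; simpl; rewrite Rmult_0_l, Cplus_0_r; ring. }
assert (EN : f (2 ^ n)%nat = sgn (2 ^ n) * Ccot (y / Cpow2 (S n) + RtoC (PI / 2))).
{ unfold f; rewrite HI'; do 2 f_equal; field; cnz. }
rewrite E0, EN in E.
apply (f_equal (fun t => t / Cpow2 (S n))) in E.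
transitivity (Cpow2 (S n) / Csin y / Cpow2 (S n)); [field; cnz|].
rewrite <- E; unfold Cdiv at 1; rewrite Cmult_plus_distr_r, Cmult_plus_distr_r.
f_equal.
rewrite Cmult_comm, <- csum_scal.
apply csum_ext; intros k Hk.
set (u := y / Cpow2 (S n)); set (t := csc_pole k / Cpow2 (S n)).
(* A zero of sin at u + t would persist under multiplication by 2^(n+1), giving sin (y + (k+1) PI) =
   0 and hence sin y = 0. *)
assert (Hp : Csin (u + t) <> 0).
{ intros Z; apply (Csin_pow2_mult (S n)) in Z.
  replace (Cpow2 (S n) * (u + t)) with (y + csc_pole k) in Z by (unfold u, t; field; cnz).
  unfold csc_pole in Z; rewrite Csin_plus_nPI in Z.
  exact (Cmult_neq_0 _ _ (sgn_neq_0 (S k)) Hy Z). }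
assert (Hm : Csin (u - t) <> 0).
{ intros Z; apply (Csin_pow2_mult (S n)) in Z.
  replace (Cpow2 (S n) * (u - t)) with (y - csc_pole k) in Z by (unfold u, t; field; cnz).
  unfold csc_pole in Z; rewrite Csin_minus_nPI in Z.
  exact (Cmult_neq_0 _ _ (sgn_neq_0 (S k)) Hy Z). }
assert (F1 : f (S k) = sgn (S k) * Ccot (u + t)).
{ unfold f; do 2 f_equal; unfold u, t, csc_pole; field; cnz. }
assert (F2 : f (2 * 2 ^ n - S k)%nat = sgn (S k) * Ccot (u - t)).
{ unfold f.
  assert (Es : sgn (2 * 2 ^ n - S k) = sgn (S k)).
  { assert (G : sgn (2 * 2 ^ n - S k) * sgn (S k) = 1).
    { unfold sgn; rewrite <- RtoC_mult, <- pow_add.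
      replace (2 * 2 ^ n - S k + S k)%nat with (2 * 2 ^ n)%nat by lia.
      rewrite pow_1_even; reflexivity. }
    replace (sgn (2 * 2 ^ n - S k)) with (sgn (2 * 2 ^ n - S k) * (sgn (S k) * sgn (S k)))
      by (rewrite sgn_sqr; ring).
    rewrite Cmult_assoc, G; ring. }
  rewrite Es, <- (Ccot_plus_PI _ Hm); do 2 f_equal.
  rewrite minus_INR, Rmult_minus_distr_r, RtoC_minus, HI by lia.
  unfold u, t, csc_pole; field; cnz. }
rewrite F1, F2, <- Cmult_plus_distr_l, Ccot_add_sub by assumption.
unfold csc_finite_term; fold t u.
replace (2 * y / Cpow2 (S n)) with (2 * u) by (unfold u; field; cnz).
pose proof (Csin_mult_diff u t) as D.
assert (HD : Csin u * Csin u - Csin t * Csin t <> 0) by (rewrite <- D; apply Cmult_neq_0; assumption).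
field; split; [|cnz].
replace (Cpow2 (S n) * Csin u * (Cpow2 (S n) * Csin u)
   - Cpow2 (S n) * Csin t * (Cpow2 (S n) * Csin t))
  with (Cpow2 (S n) * Cpow2 (S n) * (Csin u * Csin u - Csin t * Csin t)) by ring.
repeat apply Cmult_neq_0; assumption.
Qed.

(** * Partial fractions of the cosecant *)

(** The sequence consists of the difference quotients of g at 0 with steps 2^(-n). *)
Lemma is_lim_seq_pow2_scaled (g : R -> R) (l : R) :
  g 0%R = 0%R -> derivable_pt_lim g 0 l ->
  is_lim_seq (fun n => 2 ^ n * g (/ 2 ^ n))%R l.
Proof.
intros H0 Hg; apply is_lim_seq_spec; intros eps.
destruct (Hg eps (cond_pos eps)) as [d Hd].
assert (L : is_lim_seq (fun n => (/ 2) ^ n)%R 0%R).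
{ apply is_lim_seq_geom; rewrite Rabs_pos_eq; lra. }
apply is_lim_seq_spec in L; destruct (L d) as [N HN]; exists N; intros n Hn.
specialize (HN n Hn); rewrite Rminus_0_r, pow_inv in HN.
assert (Hp : (0 < 2 ^ n)%R) by (apply pow_lt; lra).
assert (Hi : (/ 2 ^ n <> 0)%R) by (apply Rinv_neq_0_compat; lra).
specialize (Hd _ Hi HN); rewrite Rplus_0_l, H0 in Hd.
replace (2 ^ n * g (/ 2 ^ n))%R with ((g (/ 2 ^ n) - 0) / / 2 ^ n)%R by (field; lra).
exact Hd.
Qed.

Lemma cvg_pow2_Csin (w : C) : cvg (fun n => Cpow2 n * Csin (w / Cpow2 n)) w.
Proof.
destruct w as [x y].
apply cvg_ext with (fun n => (2 ^ n * (sin (x * / 2 ^ n) * cosh (y * / 2 ^ n)),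
                         2 ^ n * (cos (x * / 2 ^ n) * sinh (y * / 2 ^ n)))%R).
- intros n.
  assert (Hp : (0 < 2 ^ n)%R) by (apply pow_lt; lra).
  replace ((x, y) / Cpow2 n) with (x * / 2 ^ n, y * / 2 ^ n)%R.
  + rewrite Csin_re_im; unfold Cpow2, RtoC, Cmult; simpl; f_equal; ring.
  + unfold Cpow2, Cdiv; rewrite <- RtoC_inv by lra.
    unfold Cmult, RtoC; simpl; f_equal; ring.
- apply cvg_pair;
    [apply (is_lim_seq_pow2_scaled (fun t => (sin (x * t) * cosh (y * t))%R))
    |apply (is_lim_seq_pow2_scaled (fun t => (cos (x * t) * sinh (y * t))%R))].
  + rewrite !Rmult_0_r, sin_0; ring.
  + apply is_derive_Reals; auto_derive; [trivial|].
    rewrite !Rmult_0_r, sin_0, cos_0, cosh_0; ring.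
  + rewrite !Rmult_0_r, sinh_0; ring.
  + apply is_derive_Reals; auto_derive; [trivial|].
    rewrite !Rmult_0_r, sinh_0, cos_0, cosh_0; ring.
Qed.

Lemma cvg_inv_pow2 : cvg (fun n => / Cpow2 n) 0.
Proof.
apply cvg_ext with (fun n => RtoC ((/ 2) ^ n)).
- intros n; unfold Cpow2; rewrite pow_inv; apply RtoC_inv, pow_nonzero; lra.
- apply cvg_RtoC, is_lim_seq_geom; rewrite Rabs_pos_eq; lra.
Qed.

Lemma cvg_Csin_pow2 (w : C) : cvg (fun n => Csin (w / Cpow2 n)) 0.
Proof.
apply cvg_ext with (fun n => (Cpow2 n * Csin (w / Cpow2 n)) * / Cpow2 n).
- intros n; pose proof (Cpow2_neq_0 n); field; cnz.
- replace (RtoC 0) with (w * 0) by ring.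
  apply cvg_mult; [apply cvg_pow2_Csin|apply cvg_inv_pow2].
Qed.

Lemma cvg_Ccos_pow2 (w : C) : cvg (fun n => Ccos (w / Cpow2 n)) 1.
Proof.
apply cvg_ext with (fun n => 1 - 2 * (Csin ((w / 2) / Cpow2 n) * Csin ((w / 2) / Cpow2 n))).
- intros n; rewrite <- Ccos_double; f_equal; pose proof (Cpow2_neq_0 n); field; cnz.
- apply cvg_lim_eq with (1 - 2 * (0 * 0)); [ring|].
  apply cvg_minus; [apply cvg_const|].
  apply cvg_mult; [apply cvg_const|].
  apply cvg_mult; apply cvg_Csin_pow2.
Qed.

(** From sin t >= t - t^3 / 6 with t <= 2, so that t^3 / 6 <= 2 t / 3. The loss of a factor 3 is
    harmless because PI > 3 makes up for it in [pow2_sin_pole_ge]. *)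
Lemma sin_ge_third (t : R) : (0 <= t <= PI / 2 -> t / 3 <= sin t)%R.
Proof.
intros Ht; pose proof PI_4.
destruct (sin_bound t 0) as [L _]; [lra|lra|].
unfold sin_approx, sin_term in L; simpl in L; nra.
Qed.

Lemma pow2_sin_pole_ge (n k : nat) : (k < 2 ^ n - 1)%nat ->
  (INR (S k) <= Cmod (Cpow2 (S n) * Csin (csc_pole k / Cpow2 (S n))))%R.
Proof.
intros Hk; unfold Cpow2, csc_pole.
assert (Hp : (0 < 2 ^ S n)%R) by (apply pow_lt; lra).
rewrite <- RtoC_div, Csin_RtoC, <- RtoC_mult, Cmod_R by lra.
apply Rle_trans with (2 := Rle_abs _).
pose proof PI2_3_2 as HPI.
assert (Hk0 : (0 <= INR (S k))%R) by apply pos_INR.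
assert (Hk1 : (INR (S k) <= 2 ^ n)%R).
{ change 2%R with (INR 2); rewrite <- pow_INR; apply le_INR; lia. }
assert (S1 : (INR (S k) * PI / 2 ^ S n / 3 <= sin (INR (S k) * PI / 2 ^ S n))%R).
{ apply sin_ge_third; split.
  - apply Rle_div_r; [exact Hp|]; nra.
  - apply Rle_div_l; [exact Hp|].
    replace (PI / 2 * 2 ^ S n)%R with (2 ^ n * PI)%R by (simpl pow; field).
    apply Rmult_le_compat_r; lra. }
apply Rle_trans with (2 ^ S n * (INR (S k) * PI / 2 ^ S n / 3))%R.
- replace (2 ^ S n * (INR (S k) * PI / 2 ^ S n / 3))%R with (INR (S k) * (PI / 3))%R by (field; lra).
  nra.
- apply Rmult_le_compat_l; lra.
Qed.

Lemma csc_pole_neq (w : C) (k : nat) : Csin w <> 0 -> w * w - csc_pole k * csc_pole k <> 0.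
Proof.
intros Hw E.
replace (w * w - csc_pole k * csc_pole k) with ((w - csc_pole k) * (w + csc_pole k)) in E by ring.
revert E; apply Cmult_neq_0; intros E; apply Hw.
- replace w with (0 + RtoC (INR (S k) * PI)) by (rewrite <- E; unfold csc_pole; ring).
  rewrite Csin_plus_nPI, Csin_RtoC, sin_0; ring.
- replace w with (0 - RtoC (INR (S k) * PI)) by (rewrite <- E; unfold csc_pole; ring).
  rewrite Csin_minus_nPI, Csin_RtoC, sin_0; ring.
Qed.

(** The polar parts of 1 / sin at the two poles +-(k+1) PI, added up; the residue at both is
    (-1)^(k+1). *)
Definition csc_term (w : C) (k : nat) : C :=
  sgn (S k) * (2 * w) / (w * w - csc_pole k * csc_pole k).

Definition csc_partial (n : nat) (w : C) : C := / w + csum (csc_term w) n.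

Lemma cvg_S (u : nat -> C) (l : C) : cvg u l -> cvg (fun n => u (S n)) l.
Proof. apply cvg_subseq; intros A; exists A; lia. Qed.

Lemma cvg_sgn_0 (u : nat -> C) (phi : nat -> nat) :
  cvg u 0 -> cvg (fun n => sgn (phi n) * u n) 0.
Proof.
intros H eps He; destruct (H eps He) as [N HN]; exists N; intros n Hn.
replace (sgn (phi n) * u n - 0) with (sgn (phi n) * (u n - 0)) by ring.
rewrite Cmod_mult, Cmod_sgn, Rmult_1_l; auto.
Qed.

Lemma csc_finite_term_bound (y : C) : exists c k0 n0, forall n k,
  (n0 <= n)%nat -> (k0 <= k < 2 ^ n - 1)%nat ->
  (Cmod (csc_finite_term y n k) <= c / INR (S k) ^ 2)%R.
Proof.
destruct (cvg_bounded _ _ (cvg_S _ _ (cvg_pow2_Csin (2 * y)))) as [N1 H1].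
destruct (cvg_bounded _ _ (cvg_S _ _ (cvg_pow2_Csin y))) as [N2 H2].
pose proof (Cmod_ge_0 y) as Y0; pose proof (Cmod_ge_0 (2 * y)) as Y1.
(* Beyond [k0] the square of the scaled sine of y is at most (k+1)^2 / 4, while that of the pole is
   at least (k+1)^2. The denominator is then at least (k+1)^2 / 2, whence the factor 2 in the
   constant. *)
destruct (INR_unbounded (2 * (Cmod y + 1))) as [k0 Hk0].
exists (2 * (Cmod (2 * y) + 1))%R, k0, (N1 + N2)%nat; intros n k Hn Hk.
specialize (H1 n ltac:(lia)); specialize (H2 n ltac:(lia)); simpl in H1, H2.
pose proof (pow2_sin_pole_ge n k ltac:(lia)) as H3.
unfold csc_finite_term.
set (A := Cpow2 (S n) * Csin (2 * y / Cpow2 (S n))) in *.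
set (B := Cpow2 (S n) * Csin (y / Cpow2 (S n))) in *.
set (D := Cpow2 (S n) * Csin (csc_pole k / Cpow2 (S n))) in *.
assert (HkR : (2 * (Cmod y + 1) < INR (S k))%R).
{ apply Rlt_le_trans with (1 := Hk0), le_INR; lia. }
set (x := INR (S k)) in *.
assert (HD : (x ^ 2 / 2 <= Cmod (B * B - D * D))%R).
{ pose proof (Cmod_sub_ge (D * D) (B * B)) as T; rewrite Cmod_sym, !Cmod_mult in T.
  assert (x * x <= Cmod D * Cmod D)%R by (apply Rmult_le_compat; lra).
  pose proof (Cmod_ge_0 B).
  assert (Cmod B * Cmod B <= (Cmod y + 1) * (Cmod y + 1))%R by (apply Rmult_le_compat; lra).
  nra. }
assert (Hx : (0 < x ^ 2)%R) by (apply pow_lt; lra).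
assert (HD0 : B * B - D * D <> 0) by (apply Cmod_gt_0; lra).
rewrite Cmod_div, Cmod_mult, Cmod_sgn, Rmult_1_l by exact HD0.
apply Rle_trans with ((Cmod (2 * y) + 1) * / (x ^ 2 / 2))%R.
- apply Rmult_le_compat; [apply Cmod_ge_0| |exact H1|].
  + apply Rlt_le, Rinv_0_lt_compat; lra.
  + apply Rinv_le_contravar; lra.
- right; field; lra.
Qed.

Lemma csc_finite_term_cvg (y : C) (k : nat) : Csin y <> 0 ->
  cvg (fun n => csc_finite_term y n k) (csc_term y k).
Proof.
intros Hy; unfold csc_finite_term, csc_term.
apply cvg_div; [apply csc_pole_neq, Hy| |].
- apply cvg_mult; [apply cvg_const|apply (cvg_S _ _ (cvg_pow2_Csin (2 * y)))].
- apply cvg_minus.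
  + apply cvg_mult; apply (cvg_S _ _ (cvg_pow2_Csin y)).
  + apply cvg_mult; apply (cvg_S _ _ (cvg_pow2_Csin (csc_pole k))).
Qed.

Lemma Csin_0 : Csin 0 = 0.
Proof. rewrite Csin_RtoC, sin_0; reflexivity. Qed.

Lemma pow2_nat_unbounded (A : nat) :
  exists N, forall n, (N <= n)%nat -> (A <= 2 ^ n - 1)%nat.
Proof.
exists (S A); intros n Hn.
pose proof (Nat.pow_gt_lin_r 2 n ltac:(lia)); lia.
Qed.

Lemma csc_partial_cvg (y : C) : Csin y <> 0 -> cvg (fun n => csc_partial n y) (/ Csin y).
Proof.
intros Hy.
assert (Hy0 : y <> 0) by (intros E; apply Hy; rewrite E; apply Csin_0).
(* In the bracket, [/ y] and 0 are the limits of the two boundary terms of [csc_finite]. *)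
replace (/ Csin y) with (/ y + (/ Csin y - (/ y + 0))) by ring.
apply cvg_plus; [apply cvg_const|].
destruct (csc_finite_term_bound y) as (c & k0 & n0 & Hb).
apply (tannery (csc_finite_term y) _ (fun n => 2 ^ n - 1)%nat c k0 n0).
- exact pow2_nat_unbounded.
- exact Hb.
- intros k; apply csc_finite_term_cvg, Hy.
- apply cvg_ext with (fun n => / Csin y - (Ccot (y / Cpow2 (S n)) / Cpow2 (S n)
    + sgn (2 ^ n) * (Ccot (y / Cpow2 (S n) + RtoC (PI / 2)) / Cpow2 (S n)))).
  + intros n; rewrite (csc_finite n y Hy) at 1; unfold Cdiv; ring.
  + apply cvg_minus; [apply cvg_const|]; apply cvg_plus.
    * apply cvg_ext with (fun n => Ccos (y / Cpow2 (S n)) / (Cpow2 (S n) * Csin (y / Cpow2 (S n)))).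
      { intros n; unfold Ccot; pose proof (Cpow2_neq_0 (S n)).
        field; split; [|cnz].
        intros E; apply (Csin_pow2_mult (S n)) in E; apply Hy; rewrite <- E; f_equal; field; cnz. }
      apply cvg_lim_eq with (1 / y); [field; cnz|].
      apply cvg_div; [exact Hy0|apply (cvg_S _ _ (cvg_Ccos_pow2 y))|apply (cvg_S _ _ (cvg_pow2_Csin y))].
    * apply cvg_sgn_0.
      apply cvg_ext with (fun n => - Csin (y / Cpow2 (S n)) / Ccos (y / Cpow2 (S n)) * / Cpow2 (S n)).
      { intros n; unfold Ccot; rewrite Csin_plus_PI2, Ccos_plus_PI2; reflexivity. }
      apply cvg_lim_eq with (- (0) / 1 * 0); [ring|].
      apply cvg_mult; [|apply (cvg_S _ _ cvg_inv_pow2)].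
      apply cvg_div; [apply C1_nz| |apply (cvg_S _ _ (cvg_Ccos_pow2 y))].
      apply cvg_opp, (cvg_S _ _ (cvg_Csin_pow2 y)).
Qed.

(** * Partial fractions of the secant, and uniform bounds *)

Lemma Copp_neq_0 (z : C) : z <> 0 -> - z <> 0.
Proof. intros H E; apply H; replace z with (- - z) by ring; rewrite E; ring. Qed.

Definition sec_pole (k : nat) : C := RtoC ((INR k + / 2) * PI).

(** This is (-1)^k (1 / (q + v) + 1 / (q - v)) with q = (k + 1/2) PI, the polar parts of sec at +-q.
    It decays only like 1 / k. *)
Definition sec_term (v : C) (k : nat) : C :=
  sgn k * (2 * sec_pole k) / (sec_pole k * sec_pole k - v * v).

Definition sec_partial (n : nat) (v : C) : C := csum (sec_term v) n.

Lemma sec_pole_csc_pole (k : nat) : csc_pole k = sec_pole k + RtoC (PI / 2).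
Proof. unfold csc_pole, sec_pole; rewrite <- RtoC_plus, S_INR; f_equal; field. Qed.

Lemma sec_pole_S (k : nat) : sec_pole (S k) = sec_pole k + RtoC PI.
Proof. unfold sec_pole; rewrite <- RtoC_plus, S_INR; f_equal; field. Qed.

Lemma sec_pole_neq (v : C) (k : nat) : Ccos v <> 0 ->
  sec_pole k + v <> 0 /\ sec_pole k - v <> 0.
Proof.
intros Hv; split; intros E; apply Hv.
- replace v with (- sec_pole k) by (rewrite <- (Cplus_0_l (- _)), <- E; ring).
  unfold sec_pole; rewrite Rmult_plus_distr_r, RtoC_plus, Cplus_comm, Ccos_opp, Ccos_plus_nPI.
  rewrite Ccos_RtoC; replace (/ 2 * PI)%R with (PI / 2)%R by field; rewrite cos_PI2; ring.
- replace v with (sec_pole k) by (rewrite <- (Cplus_0_l v), <- E; ring).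
  unfold sec_pole; rewrite Rmult_plus_distr_r, RtoC_plus, Cplus_comm, Ccos_plus_nPI.
  rewrite Ccos_RtoC; replace (/ 2 * PI)%R with (PI / 2)%R by field; rewrite cos_PI2; ring.
Qed.

Lemma sec_pole_sqr_neq (v : C) (k : nat) : Ccos v <> 0 ->
  sec_pole k * sec_pole k - v * v <> 0.
Proof.
intros Hv; destruct (sec_pole_neq v k Hv) as [H1 H2].
replace (sec_pole k * sec_pole k - v * v) with ((sec_pole k + v) * (sec_pole k - v)) by ring.
apply Cmult_neq_0; assumption.
Qed.

(* The poles of the two partial sums, shifted by pi/2, differ only in the last one. *)
Lemma sec_partial_csc_partial (v : C) (n : nat) : Ccos v <> 0 ->
  csc_partial n (v + RtoC (PI / 2)) = sec_partial n v + sgn n / (v + sec_pole n).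
Proof.
intros Hv; unfold csc_partial, sec_partial; induction n as [|n IH].
- unfold sgn, sec_pole; simpl.
  replace ((0 + / 2) * PI)%R with (PI / 2)%R by field; unfold Cdiv; ring.
- cbn [csum]; rewrite Cplus_assoc, IH.
  rewrite <- !Cplus_assoc; f_equal.
  unfold csc_term, sec_term; rewrite sec_pole_csc_pole, sec_pole_S, sgn_S.
  destruct (sec_pole_neq v n Hv) as [H1 H2], (sec_pole_neq v (S n) Hv) as [H3 _].
  rewrite sec_pole_S in H3.
  assert (E2 : RtoC PI = RtoC (PI / 2) + RtoC (PI / 2)) by (rewrite <- RtoC_plus; f_equal; field).
  rewrite E2 in *; set (q := sec_pole n) in *; set (h := RtoC (PI / 2)) in *.
  field; repeat split.
  + intros E; apply H3; rewrite <- E; ring.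
  + replace (q * q - v * v) with ((q + v) * (q - v)) by ring; apply Cmult_neq_0; assumption.
  + replace ((v + h) * (v + h) - (q + h) * (q + h)) with (- ((q - v) * (q + (h + h) + v))) by ring.
    apply Copp_neq_0, Cmult_neq_0; assumption.
  + intros E; apply H1; rewrite <- E; ring.
Qed.

Lemma cvg_inv_sec_pole (v : C) : cvg (fun n => / (v + sec_pole n)) 0.
Proof.
intros eps He.
destruct (INR_unbounded (Cmod v + / eps)) as [N HN]; exists N; intros n Hn.
assert (Hi := Rinv_0_lt_compat _ He).
assert (HnN : (INR N <= INR n)%R) by (apply le_INR; lia).
assert (B : (INR n <= Cmod (sec_pole n))%R).
{ unfold sec_pole; rewrite Cmod_R; apply Rle_trans with (2 := Rle_abs _).
  pose proof PI2_1; pose proof (pos_INR n); nra. }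
pose proof (Cmod_triangle (v + sec_pole n) (- v)) as T; rewrite Cmod_opp in T.
replace (v + sec_pole n + - v) with (sec_pole n) in T by ring.
replace (/ (v + sec_pole n) - 0) with (/ (v + sec_pole n)) by ring.
rewrite Cmod_inv by (apply Cmod_gt_0; lra).
rewrite <- (Rinv_inv eps); apply Rinv_lt_contravar; [|lra].
apply Rmult_lt_0_compat; lra.
Qed.

Lemma sec_partial_cvg (v : C) : Ccos v <> 0 -> cvg (fun n => sec_partial n v) (/ Ccos v).
Proof.
intros Hv.
apply cvg_ext with (fun n => csc_partial n (v + RtoC (PI / 2)) - sgn n * / (v + sec_pole n)).
- intros n; rewrite sec_partial_csc_partial by exact Hv; unfold Cdiv; ring.
- rewrite <- Csin_plus_PI2 in *.
  apply cvg_lim_eq with (/ Csin (v + RtoC (PI / 2)) - 0); [ring|].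
  apply cvg_minus; [apply csc_partial_cvg, Hv|apply cvg_sgn_0, cvg_inv_sec_pole].
Qed.

(* Grouping consecutive terms gains a power of k in the denominators. *)
Lemma alternating_sum_bounded (d : nat -> C) (c : R) (n : nat) : (0 < c)%R ->
  (forall k, c * INR (S k) <= Cmod (d k))%R ->
  (forall k, d (S k) = d k + RtoC PI) ->
  (Cmod (csum (fun k => sgn k / d k)%C n) <= 2 * (PI / (c * c)) + / c)%R.
Proof.
intros Hc Hd Hs; pose proof PI_RGT_0 as HPI.
assert (Hpos : forall k, (0 < c * INR (S k))%R).
{ intros k; apply Rmult_lt_0_compat; [exact Hc|apply lt_0_INR; lia]. }
assert (Hd0 : forall k, d k <> 0).
{ intros k; apply Cmod_gt_0; specialize (Hd k); specialize (Hpos k); lra. }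
(* Two neighbours give 1 / d - 1 / (d + PI) = PI / (d (d + PI)). An unpaired last term, when n is
   odd, costs the extra / c. *)
assert (P : forall m, (Cmod (csum (fun k => sgn k / d k)%C (2 * m)) <= 2 * (PI / (c * c)))%R).
{ intros m; rewrite csum_pairs; apply csum_bound; intros k.
  rewrite sgn_S, sgn_double.
  replace (1 / d (2 * k)%nat + - (1) / d (S (2 * k)))
    with (RtoC PI / (d (2 * k)%nat * d (S (2 * k)))).
  2: { pose proof (Hd0 (S (2 * k))) as H1; rewrite Hs in *; pose proof (Hd0 (2 * k)%nat).
       field; cnz. }
  rewrite Cmod_div, Cmod_mult, Cmod_R, Rabs_pos_eq by (try apply Cmult_neq_0; auto; lra).
  assert (Q : forall j, (S k <= j)%nat -> (c * INR (S k) <= c * INR j)%R).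
  { intros j Hj; apply Rmult_le_compat_l; [lra|apply le_INR; lia]. }
  pose proof (Hd (2 * k)%nat) as D1; pose proof (Hd (S (2 * k))) as D2.
  pose proof (Q (S (2 * k)) ltac:(lia)); pose proof (Q (S (S (2 * k))) ltac:(lia)).
  pose proof (Hpos k) as D3.
  replace (PI / (c * c) / INR (S k) ^ 2)%R with (PI * / ((c * INR (S k)) * (c * INR (S k))))%R.
  2: { assert (INR (S k) <> 0)%R by (apply not_0_INR; lia); field; lra. }
  apply Rmult_le_compat_l; [lra|]; apply Rinv_le_contravar; [nra|].
  apply Rmult_le_compat; lra. }
destruct (Nat.Even_or_Odd n) as [[m ->]|[m ->]].
- apply Rle_trans with (1 := P m); assert (0 < / c)%R by (apply Rinv_0_lt_compat, Hc); lra.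
- rewrite Nat.add_1_r; cbn [csum].
  apply Rle_trans with (1 := Cmod_triangle _ _), Rplus_le_compat; [apply P|].
  rewrite Cmod_div, Cmod_sgn by auto.
  unfold Rdiv; rewrite Rmult_1_l; apply Rinv_le_contravar; [exact Hc|].
  apply Rle_trans with (2 := Hd _).
  assert (1 <= INR (S (2 * m)))%R by (apply (le_INR 1); lia); nra.
Qed.

(** 1 and w are linearly independent over R, so t + w x controls both coordinates: |Im w| |x| and
    |t| - |w| |x| are at most its modulus. The constant e bounds |t| + (|w| + 1) |x| - |w| |x| in
    terms of that modulus. *)
Lemma sector_bound (w : C) : Im w <> 0%R -> exists c, (0 < c)%R /\
  forall t x : R, (c * (Rabs t + Rabs x) <= Cmod (RtoC t + w * RtoC x))%R.
Proof.
intros Hw.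
pose proof (Rabs_pos_lt _ Hw) as HI; pose proof (Cmod_ge_0 w) as Hm.
set (e := (1 + (Cmod w + 1) / Rabs (Im w))%R).
assert (He : (0 < e)%R).
{ unfold e; assert (0 < (Cmod w + 1) / Rabs (Im w))%R by (apply Rdiv_lt_0_compat; lra); lra. }
exists (/ e)%R; split; [apply Rinv_0_lt_compat, He|]; intros t x.
set (y := RtoC t + w * RtoC x).
assert (A : (Rabs (Im w) * Rabs x <= Cmod y)%R).
{ apply Rle_trans with (2 := Rmax_Cmod y), Rle_trans with (2 := Rmax_r _ _).
  rewrite <- Rabs_mult; right; f_equal; unfold y; destruct w; simpl; ring. }
assert (B : (Rabs t <= Cmod y + Cmod w * Rabs x)%R).
{ rewrite <- (Cmod_R x), <- (Cmod_R t), <- Cmod_mult.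
  replace (RtoC t) with (y - w * RtoC x) by (unfold y; ring).
  apply Cmod_sub_le. }
assert (X : (Rabs x <= Cmod y / Rabs (Im w))%R).
{ apply Rle_div_r; [exact HI|]; lra. }
apply Rmult_le_reg_l with e; [exact He|].
rewrite <- Rmult_assoc, Rinv_r, Rmult_1_l by lra.
apply Rle_trans with (Cmod y + (Cmod w + 1) * Rabs x)%R; [lra|].
apply Rle_trans with (Cmod y + (Cmod w + 1) * (Cmod y / Rabs (Im w)))%R.
- apply Rplus_le_compat_l, Rmult_le_compat_l; lra.
- right; unfold e; field; lra.
Qed.

Lemma Ccos_scaled_csc_pole_neq_0 (w : C) (k : nat) : Im w <> 0%R -> Ccos (w * csc_pole k) <> 0.
Proof.
intros Hw; apply Ccos_neq_0_of_Im; unfold csc_pole; rewrite im_scal_r.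
apply Rmult_integral_contrapositive; split; [exact Hw|].
apply Rmult_integral_contrapositive; split; [apply not_0_INR; lia|apply PI_neq0].
Qed.

Lemma Csin_scaled_sec_pole_neq_0 (w : C) (k : nat) : Im w <> 0%R -> Csin (w * sec_pole k) <> 0.
Proof.
intros Hw; apply Csin_neq_0_of_Im; unfold sec_pole; rewrite im_scal_r.
apply Rmult_integral_contrapositive; split; [exact Hw|].
pose proof (pos_INR k); pose proof PI_RGT_0; nra.
Qed.

(** Each [sec_term] splits into two fractions, and each resulting alternating sum has denominators
    in arithmetic progression with step PI. [sector_bound] keeps them above c (k+1) whatever j is,
    so D depends on w alone. *)
Lemma sec_partial_bounded (w : C) : Im w <> 0%R -> exists D, forall n j,
  (Cmod (sec_partial n (w * csc_pole j)) <= D)%R.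
Proof.
intros Hw; destruct (sector_bound w Hw) as (c & Hc & H).
exists ((2 * (PI / (c * c)) + / c) + (2 * (PI / (c * c)) + / c))%R; intros n j.
pose proof (Ccos_scaled_csc_pole_neq_0 w j Hw) as Hv.
assert (G : forall k (s : R), (Rabs s = 1)%R ->
  (c * INR (S k) <= Cmod (sec_pole k + RtoC s * (w * csc_pole j)))%R).
{ intros k s Hs; replace (RtoC s * (w * csc_pole j)) with (w * RtoC (s * (INR (S j) * PI)))
    by (unfold csc_pole; rewrite !RtoC_mult; ring).
  apply Rle_trans with (2 := H _ _), Rmult_le_compat_l; [lra|].
  rewrite (Rabs_mult s), Hs, !Rabs_pos_eq, !S_INR;
    pose proof PI2_1; pose proof (pos_INR k); pose proof (pos_INR j); try rewrite S_INR; nra. }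
unfold sec_partial.
rewrite (csum_ext _ (fun k => sgn k / (sec_pole k + RtoC 1 * (w * csc_pole j))
                          + sgn k / (sec_pole k + RtoC (-1) * (w * csc_pole j)))).
2: { intros k _; unfold sec_term; destruct (sec_pole_neq _ k Hv) as [H1 H2].
     pose proof (sec_pole_sqr_neq _ k Hv).
     replace (RtoC 1 * (w * csc_pole j)) with (w * csc_pole j) by ring.
     replace (RtoC (-1) * (w * csc_pole j)) with (- (w * csc_pole j)) by ring.
     field; cnz. }
rewrite csum_plus; apply Rle_trans with (1 := Cmod_triangle _ _), Rplus_le_compat;
  apply alternating_sum_bounded; try exact Hc.
- intros k; apply G, Rabs_R1.
- intros k; rewrite sec_pole_S; ring.
- intros k; apply G; rewrite Rabs_left; lra.
- intros k; rewrite sec_pole_S; ring.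
Qed.

Lemma csc_partial_bounded (w : C) : Im w <> 0%R -> exists D, forall n j,
  (Cmod (csc_partial n (w * sec_pole j)) <= D)%R.
Proof.
intros Hw; destruct (sector_bound w Hw) as (c & Hc & H).
exists ((2 * (PI / (c * c)) + / c) + (2 * (PI / (c * c)) + / c))%R; intros n j.
assert (Hj : (0 < (INR j + / 2) * PI)%R).
{ pose proof (pos_INR j); pose proof PI_RGT_0; nra. }
pose proof (Csin_scaled_sec_pole_neq_0 w j Hw) as Hv.
assert (G1 : forall k, (c * INR (S k) <= Cmod (RtoC (INR k * PI) + w * sec_pole j))%R).
{ intros k; apply Rle_trans with (2 := H _ _), Rmult_le_compat_l; [lra|].
  rewrite !Rabs_pos_eq, !S_INR;
    pose proof PI2_1; pose proof (pos_INR k); pose proof (pos_INR j); nra. }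
assert (G2 : forall k, (c * INR (S k) <= Cmod (csc_pole k - w * sec_pole j))%R).
{ intros k; replace (csc_pole k - w * sec_pole j) with (csc_pole k + w * RtoC (- ((INR j + / 2) * PI)))
    by (unfold sec_pole; rewrite RtoC_opp; ring).
  apply Rle_trans with (2 := H _ _), Rmult_le_compat_l; [lra|].
  rewrite Rabs_Ropp, !Rabs_pos_eq, !S_INR;
    pose proof PI2_1; pose proof (pos_INR k); pose proof (pos_INR j); try rewrite S_INR; nra. }
set (v := w * sec_pole j) in *.
(* The isolated term 1 / v becomes index 0 of the first sum, which therefore has one term more. At
   that index the lower bound comes from [sec_pole j] >= PI / 2 alone. *)
assert (E : csc_partial n v = csum (fun k => sgn k / (RtoC (INR k * PI) + v)) (S n)
                        + csum (fun k => sgn k / (csc_pole k - v)) n).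
{ rewrite csum_S_l, <- Cplus_assoc, <- csum_plus; unfold csc_partial; f_equal.
  - unfold sgn; simpl; rewrite Rmult_0_l, Cplus_0_l; unfold Cdiv; ring.
  - apply csum_ext; intros k _; unfold csc_term; fold (csc_pole k).
    pose proof (csc_pole_neq v k Hv) as Hn; rewrite sgn_S.
    assert (N1 : csc_pole k + v <> 0) by (intros Z; apply Hn;
      replace (v * v - csc_pole k * csc_pole k) with ((csc_pole k + v) * (v - csc_pole k)) by ring;
      rewrite Z; ring).
    assert (N2 : csc_pole k - v <> 0) by (intros Z; apply Hn;
      replace (v * v - csc_pole k * csc_pole k) with (- (csc_pole k + v) * (csc_pole k - v)) by ring;
      rewrite Z; ring).
    field; cnz. }
rewrite E; apply Rle_trans with (1 := Cmod_triangle _ _), Rplus_le_compat;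
  apply alternating_sum_bounded; try exact Hc; try assumption.
- intros k; rewrite S_INR, Rmult_plus_distr_r, RtoC_plus, Rmult_1_l; ring.
- intros k; unfold csc_pole; rewrite (S_INR (S k)), Rmult_plus_distr_r, RtoC_plus, Rmult_1_l; ring.
Qed.

(** * Product of a cosecant and a secant *)

Lemma csum_exchange (f : nat -> nat -> C) (n m : nat) :
  csum (fun k => csum (fun j => f k j) m) n = csum (fun j => csum (fun k => f k j) n) m.
Proof.
induction n as [|n IH]; simpl; [symmetry; apply csum_zero; reflexivity|].
rewrite IH, <- csum_plus; reflexivity.
Qed.

(** Multiplying sec by an odd function gives opposite values of that function at q and -q. The polar
    parts then combine as 1 / (q - w) - 1 / (q + w), with numerator 2 w in place of the 2 q of
    [sec_term]; this gains a power of k. *)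
Definition sec_weight (w : C) (k : nat) : C :=
  sgn k * (2 * w) / (sec_pole k * sec_pole k - w * w).

(* For fixed n this is an identity of rational functions of z: both sides have
   the same simple poles with the same residues. *)
Lemma partial_product (l u z : C) (n : nat) :
  l <> 0 -> u <> 0 -> z <> 0 -> Im (u / l) <> 0%R ->
  (Cmod (l * z) < 1)%R -> (Cmod (u * z) < 1)%R ->
  csc_partial n (l * z) * sec_partial n (u * z) =
  sec_partial n 0 / (l * z)
  + csum (fun k => csc_term (l * z) k * sec_partial n (u / l * csc_pole k)
                   + sec_weight (u * z) k * csc_partial n (l / u * sec_pole k)) n.
Proof.
intros Hl Hu Hz Him Hlz Huz.
assert (Hs : Csin (l * z) <> 0).
{ apply Csin_neq_0_of_small; [apply Cmult_neq_0; assumption|exact Hlz]. }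
assert (Hc : Ccos (u * z) <> 0) by (apply Ccos_neq_0_of_small, Huz).
assert (Hs0 : forall j, sec_pole j <> 0).
{ intros j; unfold sec_pole; apply RtoC_neq_0; pose proof (pos_INR j); pose proof PI_RGT_0; nra. }
(* For each pair (k, j), the product of the two polar terms is split into one part with the poles of
   csc and one with those of sec; exchanging the finite sums regroups the parts by pole. *)
assert (A : csum (fun k => csc_term (l * z) k * sec_partial n (u * z)) n
  = csum (fun k => csc_term (l * z) k * sec_partial n (u / l * csc_pole k)) n
    + csum (fun j => sec_weight (u * z) j * csum (csc_term (l / u * sec_pole j)) n) n).
{ rewrite (csum_ext (fun j => sec_weight (u * z) j * csum (csc_term (l / u * sec_pole j)) n)
    (fun j => csum (fun k => sec_weight (u * z) j * csc_term (l / u * sec_pole j) k) n))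
    by (intros; rewrite csum_scal; reflexivity).
  rewrite <- csum_exchange, <- csum_plus.
  apply csum_ext; intros k _; unfold sec_partial.
  rewrite <- !csum_scal, <- csum_plus.
  apply csum_ext; intros j _.
  unfold csc_term, sec_term, sec_weight.
  pose proof (csc_pole_neq _ k Hs) as N1.
  pose proof (sec_pole_sqr_neq _ j Hc) as N2.
  pose proof (sec_pole_sqr_neq _ j (Ccos_scaled_csc_pole_neq_0 _ k Him)) as N3.
  set (p := csc_pole k) in *; set (q := sec_pole j) in *.
  (* The common denominator of the two constant factors of the split; it is nonzero because u / l is
     nonreal. *)
  assert (N3' : q * l * (q * l) - u * p * (u * p) <> 0).
  { replace (q * l * (q * l) - u * p * (u * p))
      with ((q * q - u / l * p * (u / l * p)) * (l * l)) by (field; cnz).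
    repeat apply Cmult_neq_0; assumption. }
  assert (E1 : 2 * q / (q * q - u / l * p * (u / l * p))
    = 2 * q * (l * l) / (q * l * (q * l) - u * p * (u * p))).
  { field; cnz. }
  assert (E2 : 2 * (l / u * q) / (l / u * q * (l / u * q) - p * p)
    = 2 * (l * u * q) / (q * l * (q * l) - u * p * (u * p))).
  { field; cnz. }
  transitivity (sgn (S k) * sgn j * (2 * (l * z) / (l * z * (l * z) - p * p)
     * (2 * q / (q * q - u / l * p * (u / l * p)))
     + 2 * (u * z) / (q * q - u * z * (u * z))
     * (2 * (l / u * q) / (l / u * q * (l / u * q) - p * p)))).
  2: { unfold Cdiv; ring. }
  rewrite E1, E2; field; repeat split; assumption. }
unfold csc_partial at 1.
rewrite Cmult_plus_distr_r, (Cmult_comm (csum _ _)), <- csum_scal.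
rewrite (csum_ext (fun k => sec_partial n (u * z) * csc_term (l * z) k)
  (fun k => csc_term (l * z) k * sec_partial n (u * z))) by (intros; ring).
rewrite A, csum_plus.
(* The pole at 0 leaves the truncated sec 0 as residue; the rest supplies the isolated term [/ w] of
   [csc_partial] in each weight. *)
assert (B : / (l * z) * sec_partial n (u * z) = sec_partial n 0 / (l * z)
  + csum (fun j => sec_weight (u * z) j * / (l / u * sec_pole j)) n).
{ unfold sec_partial, Cdiv at 1; rewrite (Cmult_comm (csum _ _)), <- !csum_scal, <- csum_plus.
  apply csum_ext; intros j _; unfold sec_term, sec_weight.
  pose proof (sec_pole_sqr_neq _ j Hc) as N2; pose proof (Hs0 j).
  field; cnz. }
rewrite B.
rewrite (csum_ext (fun k => sec_weight (u * z) k * csc_partial n (l / u * sec_pole k))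
  (fun k => sec_weight (u * z) k * / (l / u * sec_pole k)
     + sec_weight (u * z) k * csum (csc_term (l / u * sec_pole k)) n))
  by (intros; unfold csc_partial; ring).
rewrite csum_plus; ring.
Qed.

(** 9/4 (k+1)^2 - 1 is at least (k+1)^2. The constant 3/2 fits the smallest pole PI / 2 of sec. *)
Lemma pole_bound (w q : C) (k : nat) : (Cmod w < 1)%R ->
  (3 / 2 * INR (S k) <= Cmod q)%R -> q * q - w * w <> 0 ->
  (Cmod (2 * w / (q * q - w * w)) <= 2 / INR (S k) ^ 2)%R.
Proof.
intros Hw Hq H0.
pose proof (Cmod_ge_0 w) as Hw0.
assert (Hx : (1 <= INR (S k))%R) by (apply (le_INR 1); lia).
set (x := INR (S k)) in *.
pose proof (Cmod_sub_ge (q * q) (w * w)) as T; rewrite !Cmod_mult in T.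
assert (3 / 2 * x * (3 / 2 * x) <= Cmod q * Cmod q)%R by (apply Rmult_le_compat; lra).
assert (G : (x ^ 2 <= Cmod (q * q - w * w))%R) by nra.
rewrite Cmod_div, Cmod_mult, Cmod_R, Rabs_pos_eq by (assumption || lra).
assert (0 < x ^ 2)%R by nra.
apply Rmult_le_compat; [nra| |lra|].
- apply Rlt_le, Rinv_0_lt_compat; lra.
- apply Rinv_le_contravar; lra.
Qed.

Lemma csc_term_bound (w : C) (k : nat) : (Cmod w < 1)%R -> Csin w <> 0 ->
  (Cmod (csc_term w k) <= 2 / INR (S k) ^ 2)%R.
Proof.
intros Hw Hs; pose proof (csc_pole_neq w k Hs) as H.
unfold csc_term.
replace (sgn (S k) * (2 * w) / (w * w - csc_pole k * csc_pole k))
  with (sgn k * (2 * w / (csc_pole k * csc_pole k - w * w))).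
- rewrite Cmod_mult, Cmod_sgn, Rmult_1_l; apply pole_bound; [exact Hw| |].
  + unfold csc_pole; rewrite Cmod_R; apply Rle_trans with (2 := Rle_abs _).
    pose proof PI2_3_2; pose proof (pos_INR (S k)); nra.
  + replace (csc_pole k * csc_pole k - w * w) with (- (w * w - csc_pole k * csc_pole k)) by ring.
    apply Copp_neq_0, H.
- rewrite sgn_S; field; split; [exact H|].
  replace (csc_pole k * csc_pole k - w * w) with (- (w * w - csc_pole k * csc_pole k)) by ring.
  apply Copp_neq_0, H.
Qed.

Lemma sec_weight_bound (w : C) (k : nat) : (Cmod w < 1)%R ->
  (Cmod (sec_weight w k) <= 2 / INR (S k) ^ 2)%R.
Proof.
intros Hw; pose proof (sec_pole_sqr_neq w k (Ccos_neq_0_of_small w Hw)) as H.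
unfold sec_weight.
replace (sgn k * (2 * w) / (sec_pole k * sec_pole k - w * w))
  with (sgn k * (2 * w / (sec_pole k * sec_pole k - w * w))) by (unfold Cdiv; ring).
rewrite Cmod_mult, Cmod_sgn, Rmult_1_l; apply pole_bound; [exact Hw| |exact H].
unfold sec_pole; rewrite Cmod_R, S_INR; apply Rle_trans with (2 := Rle_abs _).
pose proof PI2_3_2; pose proof (pos_INR k); nra.
Qed.

Lemma Ccos_0 : Ccos 0 = 1.
Proof. rewrite Ccos_RtoC, cos_0; reflexivity. Qed.

(** The limit of [partial_product], dominated by 2 / (k+1)^2 times the uniform bounds D1 and D2. The
    truncated sec 0 tends to 1, which gives the subtracted polar term. *)
Lemma csc_sec_expansion (l u z : C) :
  l <> 0 -> u <> 0 -> z <> 0 -> Im (u / l) <> 0%R -> Im (l / u) <> 0%R ->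
  (Cmod (l * z) < 1)%R -> (Cmod (u * z) < 1)%R ->
  cvg (csum (fun k => csc_term (l * z) k / Ccos (u / l * csc_pole k)
                      + sec_weight (u * z) k / Csin (l / u * sec_pole k)))
      (/ (Csin (l * z) * Ccos (u * z)) - / (l * z)).
Proof.
intros Hl Hu Hz Him Him' Hlz Huz.
assert (Hlz0 : l * z <> 0) by (apply Cmult_neq_0; assumption).
pose proof (Csin_neq_0_of_small _ Hlz0 Hlz) as Hs.
pose proof (Ccos_neq_0_of_small _ Huz) as Hc.
destruct (sec_partial_bounded _ Him) as [D1 HD1].
destruct (csc_partial_bounded _ Him') as [D2 HD2].
apply (tannery (fun n k => csc_term (l * z) k * sec_partial n (u / l * csc_pole k)
                   + sec_weight (u * z) k * csc_partial n (l / u * sec_pole k))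
  _ (fun n => n) (2 * D1 + 2 * D2) O O).
- intros A; exists A; trivial.
- intros n k _ _; apply Rle_trans with (1 := Cmod_triangle _ _).
  rewrite !Cmod_mult.
  replace ((2 * D1 + 2 * D2) / INR (S k) ^ 2)%R
    with (2 / INR (S k) ^ 2 * D1 + 2 / INR (S k) ^ 2 * D2)%R by (unfold Rdiv; ring).
  apply Rplus_le_compat; apply Rmult_le_compat; try apply Cmod_ge_0;
    auto using csc_term_bound, sec_weight_bound.
- intros k; apply cvg_plus; apply cvg_mult; try apply cvg_const.
  + apply sec_partial_cvg, Ccos_scaled_csc_pole_neq_0; assumption.
  + apply csc_partial_cvg, Csin_scaled_sec_pole_neq_0; assumption.
- apply cvg_ext with (fun n => csc_partial n (l * z) * sec_partial n (u * z)
                              - sec_partial n 0 / (l * z)).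
  + intros n; rewrite (partial_product l u z) by assumption; ring.
  + apply cvg_lim_eq with (/ Csin (l * z) * / Ccos (u * z) - / Ccos 0 / (l * z)).
    { rewrite Ccos_0; field; repeat split; try assumption; apply C1_nz. }
    apply cvg_minus; [apply cvg_mult|apply cvg_mult; [|apply cvg_const]].
    * apply csc_partial_cvg, Hs.
    * apply sec_partial_cvg, Hc.
    * apply sec_partial_cvg; rewrite Ccos_0; apply C1_nz.
Qed.

(** * Sums over the poles as generating functions of psi *)

(** For x = a z and w = tau / a, the two polar parts of the kernel at x = +-p with p = (j+1) PI: the
    residue in x is sec (p w) / 2. For b in place of a the kernel carries the opposite sign. *)
Definition pole_term (x w : C) (j : nat) : C :=
  x / (x * x - csc_pole j * csc_pole j) * Csec (csc_pole j * w).

Lemma Cmod_Csec_le (w : C) (j : nat) : Im w <> 0%R ->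
  (Cmod (Csec (csc_pole j * w)) <= / Rabs (Im w))%R.
Proof.
intros Hw; pose proof (Rabs_pos_lt _ Hw) as HI.
pose proof (Cmod_Ccos_ge (csc_pole j * w)) as H.
unfold csc_pole in *; rewrite im_scal_l, Rabs_mult in H.
assert (1 <= INR (S j) * PI)%R.
{ pose proof PI2_1; assert (1 <= INR (S j))%R by (apply (le_INR 1); lia); nra. }
rewrite (Rabs_pos_eq (INR (S j) * PI)) in H by lra.
assert (Rabs (Im w) <= Cmod (Ccos (RtoC (INR (S j) * PI) * w)))%R by nra.
unfold Csec; rewrite Cmod_inv by (apply Cmod_gt_0; lra).
apply Rinv_le_contravar; assumption.
Qed.

Lemma small_pole_neq (x : C) (j : nat) : (Cmod x < 1)%R ->
  csc_pole j * csc_pole j - x * x <> 0.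
Proof.
intros Hx E.
assert (H : (Cmod (csc_pole j * csc_pole j) = Cmod (x * x))%R).
{ f_equal; replace (csc_pole j * csc_pole j) with (csc_pole j * csc_pole j - x * x + x * x) by ring.
  rewrite E; ring. }
rewrite !Cmod_mult in H; unfold csc_pole in H; rewrite Cmod_R in H.
assert (1 <= INR (S j) * PI)%R.
{ pose proof PI2_1; assert (1 <= INR (S j))%R by (apply (le_INR 1); lia); nra. }
rewrite Rabs_pos_eq in H by lra; pose proof (Cmod_ge_0 x); nra.
Qed.

Lemma pole_term_bound (x w : C) (j : nat) : (Cmod x < 1)%R -> Im w <> 0%R ->
  (Cmod (pole_term x w j) <= / Rabs (Im w) / INR (S j) ^ 2)%R.
Proof.
intros Hx Hw; pose proof (small_pole_neq x j Hx) as H0.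
assert (B : (Cmod (2 * x / (csc_pole j * csc_pole j - x * x)) <= 2 / INR (S j) ^ 2)%R).
{ apply pole_bound; [exact Hx| |exact H0].
  unfold csc_pole; rewrite Cmod_R; apply Rle_trans with (2 := Rle_abs _).
  pose proof PI2_3_2; pose proof (pos_INR (S j)); nra. }
unfold pole_term.
replace (x / (x * x - csc_pole j * csc_pole j))
  with (RtoC (- / 2) * (2 * x / (csc_pole j * csc_pole j - x * x))).
2: { assert (x * x - csc_pole j * csc_pole j <> 0).
     { replace (x * x - csc_pole j * csc_pole j) with (- (csc_pole j * csc_pole j - x * x)) by ring.
       apply Copp_neq_0, H0. }
     rewrite RtoC_opp, RtoC_inv by lra; field; cnz. }
rewrite 2!Cmod_mult, Cmod_R, Rabs_left by lra.
pose proof (Cmod_Csec_le w j Hw) as HS.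
apply Rle_trans with (- - / 2 * (2 / INR (S j) ^ 2) * / Rabs (Im w))%R.
- pose proof (Cmod_ge_0 (2 * x / (csc_pole j * csc_pole j - x * x))).
  apply Rmult_le_compat; [apply Rmult_le_pos; lra|apply Cmod_ge_0| |exact HS].
  apply Rmult_le_compat_l; lra.
- right; unfold Rdiv; field.
  split; [apply not_0_INR; lia|apply Rabs_no_R0, Hw].
Qed.

Lemma secant_term_alt (m : nat) (w : C) (j : nat) :
  secant_term (2 * Z.of_nat m) w j = Csec (csc_pole j * w) / RtoC (INR (S j)) ^ (2 * m).
Proof.
unfold secant_term; f_equal.
- f_equal; f_equal; unfold csc_pole; rewrite RtoC_mult; ring.
- rewrite <- RtoC_pow; f_equal.
  rewrite pow_powerRZ; f_equal; lia.
Qed.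

(** [psi] is defined by description, so a limit has to be produced before it can be named: the
    secants are bounded and the exponent is at least 2. *)
Lemma psi_cvg (m : nat) (w : C) : Im w <> 0%R ->
  cvg (csum (secant_term (2 * Z.of_nat (S m)) w)) (psi (2 * Z.of_nat (S m)) w).
Proof.
intros Hw.
destruct (csum_cvg_of_bound (secant_term (2 * Z.of_nat (S m)) w) (/ Rabs (Im w))%R) as [l Hl].
- intros j; rewrite secant_term_alt.
  assert (Hj : (1 <= INR (S j))%R) by (apply (le_INR 1); lia).
  assert (Hj0 : RtoC (INR (S j)) <> 0) by (apply RtoC_neq_0; lra).
  rewrite Cmod_div, Cmod_pow, Cmod_R, Rabs_pos_eq by (lra || apply Cpow_nz, Hj0).
  assert (0 < INR (S j) ^ 2)%R by (apply pow_lt; lra).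
  apply Rmult_le_compat; [apply Cmod_ge_0| |apply Cmod_Csec_le, Hw|].
  + apply Rlt_le, Rinv_0_lt_compat, pow_lt; lra.
  + apply Rinv_le_contravar; [assumption|]; apply Rle_pow; [exact Hj|lia].
- rewrite (psi_unique _ _ l (is_series_of_cvg _ _ Hl)); exact Hl.
Qed.

Definition psi_coef (x w : C) (m : nat) : C :=
  x ^ S (2 * m) * psi (2 * Z.of_nat (S m)) w / RtoC PI ^ (2 * S m).

Lemma PI_C_neq_0 : RtoC PI <> 0.
Proof. apply RtoC_neq_0, PI_neq0. Qed.

(** The induction step is x / (x^2 - p^2) (x / p)^2 = x / (x^2 - p^2) + x / p^2, scaled by (x /
    p)^(2M): the additional term, summed over the poles, is one value of psi. *)
Lemma pole_term_geometric (x w H : C) (M : nat) : (Cmod x < 1)%R -> Im w <> 0%R ->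
  cvg (csum (pole_term x w)) H ->
  cvg (csum (fun j => pole_term x w j * (x * / csc_pole j) ^ (2 * M)))
      (H + csum (psi_coef x w) M).
Proof.
intros Hx Hw HH; induction M as [|M IH].
- simpl; apply cvg_lim_eq with H; [ring|].
  apply cvg_ext with (2 := HH); intros n; apply csum_ext; intros k _; simpl; ring.
- cbn [csum]; rewrite Cplus_assoc.
  apply cvg_ext with (fun n => csum (fun j => pole_term x w j * (x * / csc_pole j) ^ (2 * M)) n
     + x ^ S (2 * M) / RtoC PI ^ (2 * S M) * csum (secant_term (2 * Z.of_nat (S M)) w) n).
  2: { apply cvg_plus; [exact IH|].
       apply cvg_lim_eq with (x ^ S (2 * M) / RtoC PI ^ (2 * S M) * psi (2 * Z.of_nat (S M)) w).
       - unfold psi_coef, Cdiv; ring.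
       - apply cvg_mult; [apply cvg_const|apply psi_cvg, Hw]. }
  intros n; rewrite <- csum_scal, <- csum_plus; apply csum_ext; intros j _.
  rewrite secant_term_alt; unfold pole_term.
  pose proof (small_pole_neq x j Hx) as H0.
  assert (Hj : RtoC (INR (S j)) <> 0) by (apply RtoC_neq_0, not_0_INR; lia).
  pose proof PI_C_neq_0 as HP.
  assert (H1 : x * x - csc_pole j * csc_pole j <> 0).
  { replace (x * x - csc_pole j * csc_pole j) with (- (csc_pole j * csc_pole j - x * x)) by ring.
    apply Copp_neq_0, H0. }
  set (s := Csec (csc_pole j * w)).
  assert (Ep : csc_pole j = RtoC (INR (S j)) * RtoC PI) by (unfold csc_pole; apply RtoC_mult).
  rewrite Ep in *; set (t := RtoC (INR (S j))) in *; set (p := RtoC PI) in *.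
  replace (2 * S M)%nat with (S (S (2 * M))) by lia.
  rewrite !Cpow_S, !Cpow_mult_l, Cpow_inv, Cpow_mult_l by (apply Cmult_neq_0; assumption).
  pose proof (Cpow_nz t (2 * M) Hj); pose proof (Cpow_nz p (2 * M) HP).
  set (T := t ^ (2 * M)) in *; set (Q := p ^ (2 * M)) in *; set (X := x ^ (2 * M)).
  field; cnz.
Qed.

Lemma psi_expansion (x w H : C) : (Cmod x < 1)%R -> Im w <> 0%R ->
  cvg (csum (pole_term x w)) H -> cvg (csum (psi_coef x w)) (- H).
Proof.
intros Hx Hw HH.
apply cvg_ext with (fun M => (H + csum (psi_coef x w) M) - H); [intros; ring|].
apply cvg_lim_eq with (0 - H); [ring|].
apply cvg_minus; [|apply cvg_const].
(* The remainder carries (x / p)^(2M) with |x| < 1 and p >= 2, hence 4^(-M) uniformly over the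
   poles; the 2 is that of [csum_bound]. *)
apply cvg_0_le with (fun M => 2 * / Rabs (Im w) * (/ 4) ^ M)%R.
2: { replace (Finite 0) with (Rbar_mult (Finite (2 * / Rabs (Im w))) (Finite 0))
       by (simpl; f_equal; ring).
     apply is_lim_seq_scal_l, is_lim_seq_geom; rewrite Rabs_pos_eq; lra. }
intros M; apply (cvg_le _ _ _ (pole_term_geometric x w H M Hx Hw HH)); intros n.
rewrite Rmult_assoc; apply csum_bound; intros j.
assert (HI : (0 < / Rabs (Im w))%R) by (apply Rinv_0_lt_compat, Rabs_pos_lt, Hw).
rewrite Cmod_mult.
replace (/ Rabs (Im w) * (/ 4) ^ M / INR (S j) ^ 2)%R
  with (/ Rabs (Im w) / INR (S j) ^ 2 * (/ 4) ^ M)%R by (unfold Rdiv; ring).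
apply Rmult_le_compat; try apply Cmod_ge_0; [apply pole_term_bound; assumption|].
assert (HP : (2 <= INR (S j) * PI)%R).
{ pose proof PI2_1; assert (1 <= INR (S j))%R by (apply (le_INR 1); lia); nra. }
rewrite Cpow_mult_r, !Cmod_pow, Cmod_mult.
unfold csc_pole; rewrite Cmod_inv, Cmod_R, Rabs_pos_eq by (try apply RtoC_neq_0; lra).
pose proof (Cmod_ge_0 x).
assert (B : (/ (INR (S j) * PI) <= / 2)%R) by (apply Rinv_le_contravar; lra).
assert (B0 : (0 < / (INR (S j) * PI))%R) by (apply Rinv_0_lt_compat; lra).
assert (Y : (0 <= Cmod x * / (INR (S j) * PI) <= / 2)%R) by (split; nra).
apply pow_incr; split; [apply pow2_ge_0|]; nra.
Qed.

Lemma pole_term_opp (x w : C) (j : nat) : pole_term x (- w) j = pole_term x w j.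
Proof.
unfold pole_term, Csec; replace (csc_pole j * - w) with (- (csc_pole j * w)) by ring.
rewrite Ccos_opp; reflexivity.
Qed.

Lemma csc_pole_even (k : nat) : csc_pole (2 * k) = 2 * sec_pole k.
Proof.
unfold csc_pole, sec_pole; rewrite <- RtoC_mult, S_INR, mult_INR; f_equal; simpl INR; field.
Qed.

Lemma csc_pole_odd (k : nat) : csc_pole (S (2 * k)) = 2 * csc_pole k.
Proof.
unfold csc_pole; rewrite <- RtoC_mult, !S_INR, mult_INR; f_equal; simpl INR; ring.
Qed.

(** The poles of csc (x / 2) are x = +-2(k+1) PI, which [csc_pole] lists at odd indices. The cosine
    is shifted by (k+1) PI, and the resulting sign cancels that of [csc_term]. *)
Lemma csc_term_pole_term (x w : C) (k : nat) : (Cmod x < 1)%R -> Im w <> 0%R ->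
  csc_term (x / 2) k / Ccos ((1 + 2 * w) * csc_pole k) = 4 * pole_term x w (S (2 * k)).
Proof.
intros Hx Hw; pose proof (small_pole_neq x (S (2 * k)) Hx) as H0.
unfold pole_term, csc_term, Csec; rewrite csc_pole_odd in *.
replace ((1 + 2 * w) * csc_pole k) with (2 * csc_pole k * w + csc_pole k) by ring.
change (2 * csc_pole k * w + csc_pole k) with (2 * csc_pole k * w + RtoC (INR (S k) * PI)).
rewrite Ccos_plus_nPI.
assert (Hc : Ccos (2 * csc_pole k * w) <> 0).
{ apply Ccos_neq_0_of_Im; unfold csc_pole; rewrite <- RtoC_mult, im_scal_l.
  apply Rmult_integral_contrapositive; split; [|exact Hw].
  pose proof PI_RGT_0; assert (0 < INR (S k))%R by (apply lt_0_INR; lia); nra. }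
pose proof (sgn_neq_0 (S k)).
set (p := csc_pole k) in *.
assert (H1 : x * x - 4 * (p * p) <> 0).
{ replace (x * x - 4 * (p * p)) with (- (2 * p * (2 * p) - x * x)) by ring.
  apply Copp_neq_0, H0. }
replace (x / 2 * (x / 2) - p * p) with ((x * x - 4 * (p * p)) / 4) by (field; cnz).
replace (x * x - 2 * p * (2 * p)) with (x * x - 4 * (p * p)) by ring.
assert (RtoC 4 <> 0) by (apply RtoC_neq_0; lra).
field; cnz.
Qed.

(** The poles of sec (x / 2) are x = +-(2k+1) PI, the even indices of [csc_pole]. The shift by (k +
    1/2) PI turns the sine into (-1)^k times a cosine; the minus sign comes from the reversed order
    in the denominator. *)
Lemma sec_weight_pole_term (x w : C) (k : nat) : (Cmod x < 1)%R -> Im w <> 0%R ->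
  sec_weight (x / 2) k / Csin ((1 + 2 * w) * sec_pole k) = - (4 * pole_term x w (2 * k)).
Proof.
intros Hx Hw; pose proof (small_pole_neq x (2 * k) Hx) as H0.
unfold pole_term, sec_weight, Csec; rewrite csc_pole_even in *.
replace (Csin ((1 + 2 * w) * sec_pole k)) with (sgn k * Ccos (2 * sec_pole k * w)).
2: { rewrite <- Csin_plus_PI2, <- Csin_plus_nPI; f_equal.
     replace ((1 + 2 * w) * sec_pole k) with (2 * sec_pole k * w + sec_pole k) by ring.
     rewrite <- Cplus_assoc, <- RtoC_plus; f_equal; unfold sec_pole; f_equal; field. }
assert (Hc : Ccos (2 * sec_pole k * w) <> 0).
{ apply Ccos_neq_0_of_Im; unfold sec_pole; rewrite <- RtoC_mult, im_scal_l.
  apply Rmult_integral_contrapositive; split; [|exact Hw].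
  pose proof PI_RGT_0; pose proof (pos_INR k); nra. }
pose proof (sgn_neq_0 k).
set (p := sec_pole k) in *.
assert (H1 : x * x - 4 * (p * p) <> 0).
{ replace (x * x - 4 * (p * p)) with (- (2 * p * (2 * p) - x * x)) by ring.
  apply Copp_neq_0, H0. }
replace (p * p - x / 2 * (x / 2)) with (- ((x * x - 4 * (p * p)) / 4)) by (field; cnz).
replace (x * x - 2 * p * (2 * p)) with (x * x - 4 * (p * p)) by ring.
assert (RtoC 4 <> 0) by (apply RtoC_neq_0; lra).
field; cnz.
Qed.

(** * The Laurent expansion *)

(** A real value q of the quotient would give t (1 - q r) = q. Taking imaginary parts forces q r =
    1, then q = 0, a contradiction. *)
Lemma Im_ratio_neq_0 (t : C) (r : R) : Im t <> 0%R -> 1 + RtoC r * t <> 0 /\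
  Im (t / (1 + RtoC r * t)) <> 0%R.
Proof.
intros Ht.
assert (Hd : 1 + RtoC r * t <> 0).
{ intros E; destruct (Req_dec r 0) as [->|Hr].
  - apply C1_nz; rewrite <- E; ring.
  - apply (f_equal Im) in E; destruct t as [x y]; simpl in *.
    assert (r * y = 0)%R by lra; apply Rmult_integral in H; tauto. }
split; [exact Hd|]; intros E.
set (q := Re (t / (1 + RtoC r * t))).
assert (Eq : t / (1 + RtoC r * t) = RtoC q).
{ unfold q; destruct (t / (1 + RtoC r * t)) as [u v]; simpl in *; rewrite E; reflexivity. }
assert (Et : t * RtoC (1 - q * r) = RtoC q).
{ rewrite RtoC_minus, RtoC_mult, <- Eq; field; exact Hd. }
assert (F := f_equal Im Et); rewrite im_scal_r, im_RtoC in F.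
apply Rmult_integral in F; destruct F as [F|F]; [exact (Ht F)|].
rewrite F, Cmult_0_r in Et; apply RtoC_inj in Et; rewrite <- Et in F; lra.
Qed.

Lemma secant_arguments_nonreal (tau : C) : Im tau <> 0%R ->
  1 - tau <> 0 /\ 1 + tau <> 0 /\
  Im (tau / (1 - tau)) <> 0%R /\ Im (tau / (1 + tau)) <> 0%R.
Proof.
intros htau.
destruct (Im_ratio_neq_0 tau 1 htau) as [H1 H2].
destruct (Im_ratio_neq_0 tau (-1) htau) as [H3 H4].
replace (1 + RtoC 1 * tau) with (1 + tau) in * by ring.
replace (1 + RtoC (-1) * tau) with (1 - tau) in * by ring.
tauto.
Qed.

Lemma kernel_expansion (tau z : C) : Im tau <> 0%R -> z <> 0 ->
  (Cmod ((1 - tau) * z) < 1)%R -> (Cmod ((1 + tau) * z) < 1)%R ->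
  exists Ha Hb,
    cvg (csum (pole_term ((1 - tau) * z) (tau / (1 - tau)))) Ha /\
    cvg (csum (pole_term ((1 + tau) * z) (tau / (1 + tau)))) Hb /\
    Csin (tau * z) / (Csin ((1 - tau) * z) * Csin ((1 + tau) * z))
      = (/ (1 - tau) - / (1 + tau)) / 2 / z + (Ha - Hb).
Proof.
intros htau Hz Hxa Hxb.
destruct (secant_arguments_nonreal tau htau) as (Na & Nb & Ia & Ib).
destruct (csum_cvg_of_bound _ _ (fun k => pole_term_bound _ _ k Hxa Ia)) as [Ha HHa].
destruct (csum_cvg_of_bound _ _ (fun k => pole_term_bound _ _ k Hxb Ib)) as [Hb HHb].
exists Ha, Hb; split; [exact HHa|split; [exact HHb|]].
set (l := (1 - tau) / 2); set (u := (1 + tau) / 2).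
pose proof C2_neq_0 as N2.
assert (Nl : l <> 0).
{ intros E; apply Na; replace (1 - tau) with (2 * l) by (unfold l; field; cnz); rewrite E; ring. }
assert (Nu : u <> 0).
{ intros E; apply Nb; replace (1 + tau) with (2 * u) by (unfold u; field; cnz); rewrite E; ring. }
assert (Rul : u / l = 1 + 2 * (tau / (1 - tau))) by (unfold l, u; field; cnz).
assert (Rlu : l / u = 1 + 2 * - (tau / (1 + tau))) by (unfold l, u; field; cnz).
assert (Ib' : Im (- (tau / (1 + tau))) <> 0%R).
{ destruct (tau / (1 + tau)) as [p q]; simpl in *; lra. }
assert (Iul : Im (u / l) <> 0%R).
{ rewrite Rul; destruct (tau / (1 - tau)) as [p q]; simpl in *; lra. }
assert (Ilu : Im (l / u) <> 0%R).
{ rewrite Rlu; destruct (tau / (1 + tau)) as [p q]; simpl in *; lra. }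
assert (El : l * z = (1 - tau) * z / 2) by (unfold l; field; cnz).
assert (Eu : u * z = (1 + tau) * z / 2) by (unfold u; field; cnz).
assert (Half : forall x, (Cmod x < 1)%R -> (Cmod (x / 2) < 1)%R).
{ intros x Hx; rewrite Cmod_div, Cmod_R, Rabs_pos_eq by (assumption || lra).
  pose proof (Cmod_ge_0 x); lra. }
assert (Hlz : (Cmod (l * z) < 1)%R) by (rewrite El; auto).
assert (Huz : (Cmod (u * z) < 1)%R) by (rewrite Eu; auto).
pose proof (csc_sec_expansion l u z Nl Nu Hz Iul Ilu Hlz Huz) as X1.
pose proof (csc_sec_expansion u l z Nu Nl Hz Ilu Iul Huz Hlz) as X2.
pose proof (cvg_minus _ _ _ _ X1 X2) as X.
(* The k-th summands of the two expansions contain, for each of a and b, the poles of index 2 k and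
   2 k + 1. Their n-th partial sums therefore match 2 n terms of [pole_term]. *)
assert (Hphi : forall A, exists N, forall n, (N <= n)%nat -> (A <= 2 * n)%nat) by (intros A; exists A; lia).
pose proof (cvg_minus _ _ _ _ (cvg_subseq _ _ _ Hphi HHa) (cvg_subseq _ _ _ Hphi HHb)) as Y.
apply (cvg_mult _ _ _ _ (cvg_const 4)) in Y.
assert (E : / (Csin (l * z) * Ccos (u * z)) - / (l * z)
   - (/ (Csin (u * z) * Ccos (l * z)) - / (u * z)) = 4 * (Ha - Hb)).
{ apply (cvg_unique _ _ _ X); apply cvg_ext with (2 := Y); intros n; cbv beta.
  rewrite !csum_pairs, <- !csum_minus, <- csum_scal.
  apply csum_ext; intros k _.
  rewrite Rul, Rlu, El, Eu.
  rewrite !csc_term_pole_term, !sec_weight_pole_term, !pole_term_opp by assumption.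
  ring. }
assert (Hs1 : Csin (l * z) <> 0) by (apply Csin_neq_0_of_small; [apply Cmult_neq_0|]; assumption).
assert (Hs2 : Csin (u * z) <> 0) by (apply Csin_neq_0_of_small; [apply Cmult_neq_0|]; assumption).
assert (Hc1 : Ccos (l * z) <> 0) by (apply Ccos_neq_0_of_small; assumption).
assert (Hc2 : Ccos (u * z) <> 0) by (apply Ccos_neq_0_of_small; assumption).
replace (Ha - Hb) with (4 * (Ha - Hb) / 4) by (field; apply RtoC_neq_0; lra).
rewrite <- E.
replace (tau * z) with (u * z + - (l * z)) by (unfold u, l; field; cnz).
replace ((1 - tau) * z) with (2 * (l * z)) by (unfold l; field; cnz).
replace ((1 + tau) * z) with (2 * (u * z)) by (unfold u; field; cnz).
replace (/ (1 - tau)) with (/ (2 * l)) by (unfold l; f_equal; field; cnz).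
replace (/ (1 + tau)) with (/ (2 * u)) by (unfold u; f_equal; field; cnz).
rewrite !Csin_double, Csin_plus, Csin_opp, Ccos_opp.
assert (RtoC 4 <> 0) by (apply RtoC_neq_0; lra).
field; cnz.
Qed.

(** The kernel is odd, so even coefficients vanish. The residue tau / ((1 - tau) (1 + tau)) is
    written in the form in which the terms [/ (l * z)] and [/ (u * z)] produce it. *)
Definition kernel_coef (tau : C) (k : Z) : C :=
  if (k =? -1)%Z then (/ (1 - tau) - / (1 + tau)) / 2
  else if ((0 <=? k)%Z && Z.odd k)%bool then
    ((1 + tau) ^ Z.to_nat k * psi (k + 1) (tau / (1 + tau))
     - (1 - tau) ^ Z.to_nat k * psi (k + 1) (tau / (1 - tau))) / RtoC PI ^ Z.to_nat (k + 1)
  else 0.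

Lemma kernel_coef_odd (tau : C) (m : nat) :
  kernel_coef tau (2 * Z.of_nat (S m) - 1) =
  ((1 + tau) ^ S (2 * m) * psi (2 * Z.of_nat (S m)) (tau / (1 + tau))
   - (1 - tau) ^ S (2 * m) * psi (2 * Z.of_nat (S m)) (tau / (1 - tau))) / RtoC PI ^ (2 * S m).
Proof.
unfold kernel_coef.
replace (2 * Z.of_nat (S m) - 1 =? -1)%Z with false by (symmetry; apply Z.eqb_neq; lia).
replace (0 <=? 2 * Z.of_nat (S m) - 1)%Z with true by (symmetry; apply Z.leb_le; lia).
replace (Z.odd (2 * Z.of_nat (S m) - 1)) with true.
2: { symmetry; apply Z.odd_spec; exists (Z.of_nat m); lia. }
cbn [andb].
replace (Z.to_nat (2 * Z.of_nat (S m) - 1)) with (S (2 * m)) by lia.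
replace (2 * Z.of_nat (S m) - 1 + 1)%Z with (2 * Z.of_nat (S m))%Z by lia.
replace (Z.to_nat (2 * Z.of_nat (S m))) with (2 * S m)%nat by lia.
reflexivity.
Qed.

Lemma kernel_coef_even (tau : C) (m : nat) : kernel_coef tau (2 * Z.of_nat m) = 0.
Proof.
unfold kernel_coef.
replace (2 * Z.of_nat m =? -1)%Z with false by (symmetry; apply Z.eqb_neq; lia).
replace (Z.odd (2 * Z.of_nat m)) with false by (rewrite Z.odd_mul; reflexivity).
rewrite Bool.andb_false_r; reflexivity.
Qed.

Lemma cvg_csum_odd_zero (h : nat -> C) (l : C) :
  (forall k, h (2 * k)%nat = 0) -> cvg (csum (fun k => h (S (2 * k)))) l -> cvg (csum h) l.
Proof.
intros H0 H.
apply cvg_ext with (fun n => csum (fun k => h (S (2 * k))) (Nat.div2 n)).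
- intros n.
  assert (P : forall m, csum h (2 * m) = csum (fun k => h (S (2 * k))) m).
  { intros m; rewrite csum_pairs; apply csum_ext; intros k _; rewrite H0; ring. }
  destruct (Nat.Even_or_Odd n) as [[m ->]|[m ->]].
  + rewrite Nat.div2_double, P; reflexivity.
  + rewrite Nat.add_1_r, Nat.div2_succ_double; cbn [csum]; rewrite P, H0; ring.
- apply (cvg_subseq _ l Nat.div2); [|exact H].
  intros A; exists (2 * A)%nat; intros n Hn.
  rewrite <- (Nat.div2_double A); apply Nat.div2_le_mono; exact Hn.
Qed.

Lemma kernel_laurent (tau : C) : Im tau <> 0%R -> is_laurent_expansion
  (fun z : C => Csin (tau * z) / (Csin ((1 - tau) * z) * Csin ((1 + tau) * z))) (kernel_coef tau).
Proof.
intros htau.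
destruct (secant_arguments_nonreal tau htau) as (Na & Nb & Ia & Ib).
pose proof (Cmod_ge_0 (1 - tau)) as Pa; pose proof (Cmod_ge_0 (1 + tau)) as Pb.
(* For |z| < 1 / s both (1 - tau) z and (1 + tau) z have modulus below 1, as [kernel_expansion]
   requires; the summand 1 makes s positive at once. *)
set (s := (Cmod (1 - tau) + Cmod (1 + tau) + 1)%R).
exists 1%nat, (/ s)%R; split; [|split].
- intros k Hk; unfold kernel_coef.
  replace (k =? -1)%Z with false by (symmetry; apply Z.eqb_neq; lia).
  replace (0 <=? k)%Z with false by (symmetry; apply Z.leb_gt; lia); reflexivity.
- apply Rinv_0_lt_compat; unfold s; lra.
- intros z [Hz0 Hz].
  assert (Hz' : z <> 0) by (apply Cmod_gt_0, Hz0).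
  assert (Hs : (s * Cmod z < 1)%R).
  { apply Rmult_lt_reg_l with (/ s)%R; [apply Rinv_0_lt_compat; unfold s; lra|].
    rewrite <- Rmult_assoc, Rinv_l, Rmult_1_l, Rmult_1_r by (unfold s; lra); exact Hz. }
  assert (Hxa : (Cmod ((1 - tau) * z) < 1)%R) by (rewrite Cmod_mult; unfold s in Hs; nra).
  assert (Hxb : (Cmod ((1 + tau) * z) < 1)%R) by (rewrite Cmod_mult; unfold s in Hs; nra).
  destruct (kernel_expansion tau z htau Hz' Hxa Hxb) as (Ha & Hb & CA & CB & ->).
  apply is_series_of_cvg.
  set (f := fun j : nat => kernel_coef tau (Z.of_nat j - Z.of_nat 1) * (z ^ j / z ^ 1)).
  (* Index j stands for the exponent j - 1: the polar term j = 0 is set aside, and [f (S j)] belongs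
     to z^j, which vanishes for even j. *)
  assert (G : cvg (csum (fun j => f (S j))) (Ha - Hb)).
  { apply cvg_csum_odd_zero.
    - intros k; unfold f.
      replace (Z.of_nat (S (2 * k)) - Z.of_nat 1)%Z with (2 * Z.of_nat k)%Z by lia.
      rewrite kernel_coef_even; ring.
    - apply cvg_lim_eq with (- Hb - - Ha); [ring|].
      apply cvg_ext with (2 := cvg_minus _ _ _ _ (psi_expansion _ _ _ Hxb Ib CB)
                                (psi_expansion _ _ _ Hxa Ia CA)).
      intros n; rewrite <- csum_minus.
      apply csum_ext; intros m _; unfold f, psi_coef.
      replace (Z.of_nat (S (S (2 * m))) - Z.of_nat 1)%Z with (2 * Z.of_nat (S m) - 1)%Z by lia.
      rewrite kernel_coef_odd, !Cpow_mult_l, (Cpow_S z (S (2 * m))), Cpow_1_r.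
      pose proof (Cpow_nz _ (2 * S m) PI_C_neq_0); field; cnz. }
  intros eps He; destruct (G eps He) as [N HN]; exists (S N); intros n Hn.
  destruct n as [|n]; [lia|]; specialize (HN n ltac:(lia)).
  rewrite csum_S_l.
  replace (f O) with ((/ (1 - tau) - / (1 + tau)) / 2 / z).
  + match goal with |- (Cmod ?t < eps)%R =>
      replace t with (csum (fun k => f (S k)) n - (Ha - Hb)) by ring end.
    exact HN.
  + unfold f; change (kernel_coef tau (Z.of_nat 0 - Z.of_nat 1)) with ((/ (1 - tau) - / (1 + tau)) / 2).
    rewrite Cpow_1_r; simpl; field; cnz.
Qed.

Theorem theorem1 (m : nat) (hm : (0 < m)%nat) (tau : C) (htau : Im tau <> 0%R) :
  (1 + tau) ^ (2 * m - 1) * psi (2 * Z.of_nat m) (tau / (1 + tau))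
    - (1 - tau) ^ (2 * m - 1) * psi (2 * Z.of_nat m) (tau / (1 - tau))
  = RtoC PI ^ (2 * m) *
    laurent_coef (2 * Z.of_nat m - 1)
      (fun z : C => Csin (tau * z) / (Csin ((1 - tau) * z) * Csin ((1 + tau) * z))).
Proof.
rewrite (laurent_coef_unique _ _ _ (kernel_laurent tau htau)).
destruct m as [|m]; [lia|].
rewrite kernel_coef_odd.
replace (2 * S m - 1)%nat with (S (2 * m)) by lia.
pose proof (Cpow_nz _ (2 * S m) PI_C_neq_0); field; cnz.
Qed.
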